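(* Consider the FIR system $y_t = b_1 u_{t-1} + \dots + b_N u_{t-N} + w_t$ satisfying the assumptions below, and run the following procedure (Algorithm 4). Fix a threshold $c_u$ such that $\mathbb{E}[u \mid u > c_u] \neq \mathbb{E}[u]$ and $\mathbb{E}[u \mid u > c_u] \neq (1-N)\mathbb{E}[u]$, where $u$ has the common distribution of the $u_t$, and step sizes $\alpha_j > 0$ with $\sum_j \alpha_j = \infty$, $\sum_j \alpha_j^2 < \infty$. Let $\tau_1 < \tau_2 < \dots$ be the successive times $t \ge 1$ with $t \bmod (N+2) \in \{1,\dots,N\}$ and $u_t > c_u$, and for $n=1,\dots,N$, $i \ge 1$ let $d_{n,i} = \frac{1}{i}\sum_{i'=1}^{i} y_{\tau_{i'}+n}$ (computed at the output quantizer). At the input quantizer let $e_{1,t} = \frac{1}{t}\sum_{t'=1}^t u_{t'}$, let $t_1 < t_2 < \dots$ be all times $t\ge1$ with $u_t > c_u$ and $e_{2,k} = \frac{1}{k}\sum_{k'=1}^k u_{t_{k'}}$. For $j \ge 1$ let $s_j = \tau_{Nj}$ and $k_j$ the number of times $t \le s_j$ with $u_t > c_u$. With zero initial values, define for $j \ge 1$ \[ \hat{d}_{n,j+1} = \hat{d}_{n,j} + \alpha_j\,\mathrm{sgn}(d_{n,Nj} - \hat{d}_{n,j}),\ n=1,\dots,N,\quad \hat{e}_{1,j+1} = \hat{e}_{1,j} + \alpha_j\,\mathrm{sgn}(e_{1,s_j} - \hat{e}_{1,j}),\quad \hat{e}_{2,j+1} = \hat{e}_{2,j} + \alpha_j\,\mathrm{sgn}(e_{2,k_j}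 - \hat{e}_{2,j}), \] (only the sign values being transmitted to the estimator), let $\mathbf{U}_j$ be the $N\times N$ matrix with all diagonal entries $\hat{e}_{2,j}$ and all off-diagonal entries $\hat{e}_{1,j}$, and set $[\hat{b}_{1,j},\dots,\hat{b}_{N,j}]^T = \mathbf{U}_j^{-1}[\hat{d}_{1,j},\dots,\hat{d}_{N,j}]^T$ if $\mathbf{U}_j$ is invertible and $=0$ otherwise. Then $\hat{b}_{n,j} \to b_n$ almost surely as $j \to \infty$, for every $n=1,\dots,N$.
   Context: Standing assumptions: the input and output quantizers have computational and storage capabilities (they can compute the running averages described, with access to the unquantized $u_t$, $y_t$); $\{u_t\}$ and $\{w_t\}$ are i.i.d. sequences, mutually independent, and $w_t$ has zero mean; the model order $N$ is known; the input distribution is not assumed known to the estimator ($\mathbb{E}[u]$ and $\mathbb{E}[u\mid u>c_u]$ are assumed to exist). The function $\mathrm{sgn}$ is defined by $\mathrm{sgn}(x) = -1$ for $x<0$ and $\mathrm{sgn}(x) = 1$ for $x>0$ (the paper does not specify a value at $0$). *)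

(* Defs.v *)
From HB Require Import structures.
From mathcomp Require Import all_boot all_order all_algebra.
From mathcomp Require Import all_classical all_reals all_analysis.
Set Implicit Arguments. Unset Strict Implicit. Unset Printing Implicit Defensive.
Import Order.TTheory GRing.Theory Num.Theory.
Import numFieldNormedType.Exports.
Local Open Scope classical_set_scope.
Local Open Scope ring_scope.

Section defs.
Context {d : measure_display} {T : measurableType d} {R : realType}.
Variable P : probability T R.

Definition mutually_independent (I : eqType) (X : I -> {RV P >-> R}) : Prop :=
  forall (s : seq I) (B : I -> set R), uniq s ->
    (forall i, i \in s -> measurable (B i)) ->
    P (\big[setI/setT]_(i <- s) (X i @^-1` B i)) =
      (\prod_(i <- s) fine (P (X i @^-1` B i)))%:E.

Definition ident_distr (X : int -> {RV P >-> R}) : Prop :=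
  forall t (A : set R), measurable A -> P (X t @^-1` A) = P (X 0 @^-1` A).

Definition joint_family (u w : int -> {RV P >-> R}) : int + int -> {RV P >-> R} :=
  fun i => match i with inl t => u t | inr t => w t end.

Definition mean (X : {RV P >-> R}) : R := fine ('E_P[X])%E.

Definition cond_mean_gt (X : {RV P >-> R}) (c : R) : R :=
  fine (\int[P]_(x in [set x | (c < X x)%R]) (X x)%:E)%E
    / fine (P [set x | c < X x]).
End defs.

Definition count_upto (p : nat -> bool) (t : nat) : nat :=
  \sum_(1 <= t' < t.+1) (p t' : nat).

(** the i-th (i >= 1) time t >= 1 with p t (0 if it does not exist) *)
Definition nth_time (p : nat -> bool) (i : nat) : nat :=
  xget 0%N [set t | (i <= count_upto p t)%N /\
                    forall t', (i <= count_upto p t')%N -> (t <= t')%N].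

Section algo.
Variable R : realType.

(** sign algorithm with zero initial value:
    x_1 = 0, x_{j+1} = x_j + alpha_j sgn(target_j - x_j) for j >= 1
    (index 0 is a dummy). sgn = Num.sg (sgn 0 = 0). *)
Fixpoint sign_rec (alpha target : nat -> R) (j : nat) : R :=
  match j with
  | 0 => 0
  | j'.+1 => if j' == 0%N then 0
             else sign_rec alpha target j' +
                  alpha j' * Num.sg (target j' - sign_rec alpha target j')
  end.

Variables (N : nat) (b : 'I_N -> R) (cu : R) (alpha : nat -> R).
Variables (u w : int -> R). (* one realization *)

Definition fir_y (t : int) : R :=
  \sum_(n < N) b n * u (t - (n.+1)%:Z) + w t.

Definition tau (i : nat) : nat :=
  nth_time (fun t => [&& (0 < t %% N.+2)%N, (t %% N.+2 <= N)%N & cu < u t%:Z]) i.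

(** d_{n,i}, n = m+1 for m : 'I_N *)
Definition dd (m : 'I_N) (i : nat) : R :=
  i%:R^-1 * \sum_(1 <= i' < i.+1) fir_y ((tau i' + m.+1)%:Z).

Definition e1 (t : nat) : R := t%:R^-1 * \sum_(1 <= t' < t.+1) u t'%:Z.

Definition tk (k : nat) : nat := nth_time (fun t => cu < u t%:Z) k.

Definition e2 (k : nat) : R := k%:R^-1 * \sum_(1 <= k' < k.+1) u (tk k')%:Z.

Definition sj (j : nat) : nat := tau (N * j).

Definition kj (j : nat) : nat := count_upto (fun t => cu < u t%:Z) (sj j).

Definition dhat (m : 'I_N) (j : nat) : R := sign_rec alpha (fun j => dd m (N * j)) j.
Definition e1hat (j : nat) : R := sign_rec alpha (fun j => e1 (sj j)) j.
Definition e2hat (j : nat) : R := sign_rec alpha (fun j => e2 (kj j)) j.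

Definition Umat (j : nat) : 'M[R]_N :=
  \matrix_(i, k) (if i == k then e2hat j else e1hat j).

Definition bhat (j : nat) : 'cV[R]_N :=
  if Umat j \in unitmx then invmx (Umat j) *m \col_m dhat m j else 0.
End algo.

(* Main.v *)
(** Almost surely, all the averages transmitted to the estimator converge, and
    everything after that is deterministic.

    With t restricted to the admissible residues, the sum of [u_t > c_u] y_{t+m}
    splits into averages of [u_t > c_u] u_{t+k} and [u_t > c_u] w_{t+m}.  For
    k != 0 the two factors are independent, and two such products at times s, t
    involve four distinct variables unless s - t is 0, k or -k.  A strong law for
    weighted sums of identically distributed, integrable terms that are
    uncorrelated (after truncation) outside a fixed distance therefore gives
    d_m -> (K - M) b_m + M sum_k b_k, where M = E[u] and K = E[u | u > c_u].

    The strong law is Etemadi's argument along the subsequences m 2^k: truncating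
    at level m 2^k, the squared centred averages have summable expectations, and
    letting m grow interpolates between the terms of the subsequences.

    A sign recursion follows any convergent target because its steps tend to 0
    and have infinite sum.  Finally the limit (K - M) I + M J of U_j, J being the
    all-ones matrix, is invertible because K != M and K != (1 - N) M. *)
Require Import Defs.
From HB Require Import structures.
From mathcomp Require Import all_boot all_order all_algebra.
From mathcomp Require Import all_classical all_reals all_analysis.
From mathcomp Require Import measurable_realfun measurable_fun_approximation.
From mathcomp Require Import ring lra zify.
Set Implicit Arguments.
Unset Strict Implicit.
Unset Printing Implicit Defensive.
Import Order.TTheory GRing.Theory Num.Theory.
Import numFieldNormedType.Exports.
Local Open Scope classical_set_scope.
Local Open Scope ring_scope.

(** * Real sequences and the sign recursion *)

Lemma sqr_cvg0 (R : realType) (v : nat -> R) :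
  (fun j => v j ^+ 2) @ \oo --> 0 -> v @ \oo --> 0.
Proof.
move=> /cvgr0Pnorm_lt v2; apply/cvgr0Pnorm_lt => e e0.
have /v2 : 0 < e ^+ 2 by rewrite exprn_gt0.
apply: filterS => j; rewrite normrX => h.
by rewrite -(@ltr_pXn2r _ 2) ?nnegrE// ltW.
Qed.

Lemma eq_cvgn (R : realType) (f g : nat -> R) (l : R) :
  (forall n, f n = g n) -> f @ \oo --> l -> g @ \oo --> l.
Proof. by move=> /funext ->. Qed.

Lemma cvg_sumn (R : realType) (I : Type) (r : seq I) (f : I -> nat -> R)
    (l : I -> R) : (forall i, f i @ \oo --> l i) ->
  (fun n => \sum_(i <- r) f i n) @ \oo --> \sum_(i <- r) l i.
Proof.
move=> fl; elim: r => [|i r IH].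
  by rewrite big_nil; apply: eq_cvgn (cvg_cst _) => n; rewrite big_nil.
rewrite big_cons; apply: eq_cvgn (cvgD (fl i) IH) => n.
by rewrite big_cons.
Qed.

Lemma cvg_sumn0 (R : realType) (I : Type) (r : seq I) (f : I -> nat -> R) :
  (forall i, f i @ \oo --> 0) -> (fun n => \sum_(i <- r) f i n) @ \oo --> 0.
Proof. by move=> f0; move: (cvg_sumn (r := r) f0); rewrite big1_eq. Qed.

Lemma cvgD0 {R : realType} (f g h : nat -> R) :
  f @ \oo --> 0 -> g @ \oo --> 0 -> (forall n, h n = f n + g n) ->
  h @ \oo --> 0.
Proof. by move=> f0 g0 /funext ->; rewrite -(addr0 0); exact: cvgD. Qed.

Lemma cvgB0 {R : realType} (f g h : nat -> R) :
  f @ \oo --> 0 -> g @ \oo --> 0 -> (forall n, h n = f n - g n) ->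
  h @ \oo --> 0.
Proof. by move=> f0 g0 /funext ->; rewrite -(subr0 0); exact: cvgB. Qed.

(** Once the targets are within [e] of [L] and the steps are below [e], an iterate farther than
    [2 * e] from [L] moves towards [L] by its full step, and one inside this tube cannot leave it.
    Divergence of the step sum forces entry into the tube. *)
Lemma sign_rec_cvg (R : realType) (alpha target : nat -> R) (L : R) :
  (forall j, (0 < j)%N -> 0 < alpha j) ->
  series (fun j => alpha j.+1) @ \oo --> +oo ->
  (fun j => alpha j.+1) @ \oo --> 0 ->
  target @ \oo --> L -> sign_rec alpha target @ \oo --> L.
Proof.
move=> a0 asum alim tlim.
apply/cvgrPdist_le => /= e0 e00.
pose e := e0 / 2; have e_gt0 : 0 < e by rewrite divr_gt0.
have e2 : e0 = 2 * e by rewrite /e mulrC divfK.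
pose x := sign_rec alpha target.
have [J HJ] : exists J, forall j, (J <= j)%N ->
    `|target j.+1 - L| < e /\ alpha j.+1 < e.
  have /cvgrPdist_lt /(_ _ e_gt0) [J1 _ H1] := tlim.
  have /cvgr0Pnorm_lt /(_ _ e_gt0) [J2 _ H2] := alim.
  exists (maxn J1 J2) => j; rewrite geq_max => /andP[j1 j2]; split.
    by rewrite distrC; apply: H1 => /=; apply: leqW.
  by apply: le_lt_trans (H2 _ j2); rewrite /= ler_norm.
have xS j : x j.+2 = x j.+1 + alpha j.+1 * Num.sg (target j.+1 - x j.+1) by [].
have stay j : (J <= j)%N -> `|x j.+1 - L| <= 2 * e -> `|x j.+2 - L| <= 2 * e.
  move=> /HJ[tj aj]; have ajp := a0 j.+1 isT; rewrite xS.
  move: tj; rewrite ltr_norml !ler_norml => /andP[t1 t2] /andP[x1 x2].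
  by apply/andP; case: (ltrgt0P (target j.+1 - x j.+1)) => h;
    first [rewrite (gtr0_sg h) | rewrite (ltr0_sg h) | rewrite h sgr0];
    split; lra.
have decr j : (J <= j)%N -> 2 * e < `|x j.+1 - L| ->
    `|x j.+2 - L| <= `|x j.+1 - L| - alpha j.+1.
  move=> /HJ[tj aj]; have ajp := a0 j.+1 isT; rewrite xS.
  move: tj; rewrite ltr_norml => /andP[t1 t2].
  have [h|h] := ler0P (x j.+1 - L).
    move=> xe; rewrite gtr0_sg; last by lra.
    by rewrite ler_norml; apply/andP; split; lra.
  move=> xe; rewrite ltr0_sg; last by lra.
  by rewrite ler_norml; apply/andP; split; lra.
have [j Jj xj] : exists2 j, (J <= j)%N & `|x j.+1 - L| <= 2 * e.
  apply: contrapT => H.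
  have far j : (J <= j)%N -> 2 * e < `|x j.+1 - L|.
    by move=> Jj; rewrite ltNge; apply/negP => xj; apply: H; exists j.
  pose s := series (fun j => alpha j.+1).
  (* Outside the tube the distance plus the sum of past steps cannot increase, which contradicts the
     divergence of that sum. *)
  have bd k : `|x (J + k).+1 - L| + s (J + k)%N <= `|x J.+1 - L| + s J.
    elim: k => [|k IH]; first by rewrite addn0.
    have := decr (J + k)%N (leq_addr _ _) (far _ (leq_addr _ _)).
    rewrite addnS /s seriesSr -/s; move: IH; lra.
  have /cvgryPgt /(_ (`|x J.+1 - L| + s J)) [K _ HK] := asum.
  have := HK (J + K)%N (leq_addl _ _) => /=; rewrite -/s => h.
  by have := bd K; have := normr_ge0 (x (J + K).+1 - L); lra.
exists j.+1 => // -[//|k] /= jk; rewrite e2 distrC -/x.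
rewrite -(subnKC (_ : j <= k)%N)//.
elim: (k - j)%N => [|l IH]; first by rewrite addn0.
by rewrite addnS; apply: stay IH; rewrite (leq_trans Jj) ?leq_addr.
Qed.

(** * Occurrence times *)

Lemma count_upto0 p : count_upto p 0 = 0%N.
Proof. by rewrite /count_upto big_geq. Qed.

Lemma count_uptoS p t : count_upto p t.+1 = (count_upto p t + p t.+1)%N.
Proof. by rewrite /count_upto big_nat_recr. Qed.

Lemma leq_count_upto p : {homo count_upto p : t t' / (t <= t')%N}.
Proof.
move=> t t' /subnKC <-; elim: (t' - t)%N => [|k IH]; first by rewrite addn0.
by rewrite addnS count_uptoS (leq_trans IH)// leq_addr.
Qed.

Lemma count_upto_leq p t : (count_upto p t <= t)%N.
Proof.
elim: t => [|t IH]; first by rewrite count_upto0.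
by rewrite count_uptoS; case: (p _) => /=; lia.
Qed.

Lemma nth_time_eq p i t : (i <= count_upto p t)%N ->
  (forall t', (i <= count_upto p t')%N -> (t <= t')%N) -> nth_time p i = t.
Proof.
move=> it mint; rewrite /nth_time.
set S := (X in xget _ X).
have St : S t by split.
have [h1 h2] : S (xget 0%N S) by exact: (xgetI _ St).
by apply/eqP; rewrite eqn_leq h2// mint.
Qed.

(** The counter grows by at most 1 at each time, so when it first reaches [i] it equals [i].
    Existence of such a time keeps [nth_time] from falling back on its default. *)
Lemma count_nth_time p i : (exists t, (i <= count_upto p t)%N) ->
  count_upto p (nth_time p i) = i.
Proof.
move=> ex; have [t it mint] := ex_minnP ex.
rewrite (nth_time_eq it)//; case: t it mint => [|t] it mint.
  by move: it; rewrite count_upto0 leqn0 => /eqP.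
apply/eqP; rewrite eqn_leq it andbT count_uptoS.
have : ~~ (i <= count_upto p t)%N by apply/negP => /mint; rewrite ltnn.
by case: (p _) => /=; lia.
Qed.

Lemma nth_time_ge p i : (exists t, (i <= count_upto p t)%N) ->
  (i <= nth_time p i)%N.
Proof. by move=> /count_nth_time h; rewrite -{1}h count_upto_leq. Qed.

(** Turns averages along occurrence times into sums over all times, to which a strong law applies.
    Both sides gain a term exactly when [p] holds at the new time. *)
Lemma sum_nth_time (V : nmodType) p (f : nat -> V) t :
  \sum_(1 <= i < (count_upto p t).+1) f (nth_time p i) =
  \sum_(1 <= t' < t.+1 | p t') f t'.
Proof.
elim: t => [|t IH]; first by rewrite count_upto0 !big_geq.
rewrite count_uptoS [RHS]big_mkcond big_nat_recr//= -big_mkcond -IH.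
case: (boolP (p t.+1)) => pt; last by rewrite addn0 addr0.
rewrite addn1 big_nat_recr//=; congr (_ + f _).
apply: nth_time_eq => [|t']; first by rewrite count_uptoS pt addn1.
by move=> h; rewrite ltnNge; apply/negP => /(leq_count_upto p); lia.
Qed.

(** The error [S n / K n - r] is [(S n - r * K n) / K n], with numerator o(n) and a denominator
    growing at least linearly. *)
Lemma ratio_cvg (R : realType) (S K : nat -> R) (r c : R) :
  0 < c -> (\forall n \near \oo, c * n%:R <= K n) ->
  (fun n => n%:R^-1 * (S n - r * K n)) @ \oo --> 0 ->
  (fun n => (K n)^-1 * S n) @ \oo --> r.
Proof.
move=> c0 Kc /cvgr0Pnorm_le SK.
apply/cvgrPdist_le => e e0.
have ec0 : 0 < e * c by rewrite mulr_gt0.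
near=> n.
have n0 : 0 < n%:R :> R by rewrite ltr0n; near: n; exists 1%N.
have Kn : c * n%:R <= K n by near: n.
have K0 : 0 < K n by apply: lt_le_trans Kn; rewrite mulr_gt0.
have : `|n%:R^-1 * (S n - r * K n)| <= e * c by near: n; apply: SK.
rewrite normrM normfV (gtr0_norm n0) ler_pdivrMl// => h.
rewrite distrC (_ : _ - r = (K n)^-1 * (S n - r * K n)); last first.
  by rewrite mulrBr mulrCA mulVf ?mulr1// gt_eqF.
rewrite normrM normfV (gtr0_norm K0) ler_pdivrMl// (le_trans h)//.
by have := ler_wpM2r (ltW e0) Kn; lra.
Unshelve. all: by end_near. Qed.

(** * Equicorrelated matrices *)

Section equicorrelated.
Variables (R : realType) (N : nat).

(** [U] is [(x - y) I + y J] with [J] the all-ones matrix. As the square of [J] is [N J], the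
    inverse is again a combination of [I] and [J], namely the Sherman-Morrison expression [B]. *)
Lemma equicorrelated_solve (x y : R) (d : 'cV[R]_N) :
  x - y != 0 -> x - y + N%:R * y != 0 ->
  let U := \matrix_(i, k) (if i == k then x else y) in
  (U \in unitmx) /\ forall n, (invmx U *m d) n ord0 =
    (x - y)^-1 * (d n ord0 - y / (x - y + N%:R * y) * \sum_k d k ord0).
Proof.
move=> a0 q0 U; move eqa : (x - y) a0 q0 => a a0.
move eqq : (a + _) => q q0.
pose B : 'M[R]_N := \matrix_(i, k) (a^-1 * ((i == k)%:R - y / q)).
have BU : B *m U = 1%:M.
  apply/matrixP => i j; rewrite !mxE.
  have key (s t : R) : a^-1 * (s - y / q) * (a * t + y) =
      s * (t + a^-1 * y) - y / q * t - y / q * a^-1 * y.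
    by field; rewrite a0 q0.
  under eq_bigr => k _.
    rewrite !mxE (_ : (if k == j then x else y) = a * (k == j)%:R + y); last first.
      by case: eqP => _ /=; rewrite -eqa ?mulr1 ?mulr0 ?subrK ?add0r.
    rewrite key; over.
  rewrite 2!sumrB -mulr_sumr sumr_const card_ord.
  rewrite (bigD1 i)//= eqxx mul1r big1 ?addr0; last first.
    by move=> k /negbTE ki; rewrite eq_sym ki mul0r.
  rewrite (bigD1 j)//= eqxx big1 ?addr0; last by move=> k /negbTE ->.
  rewrite /= ?mulr1 -[_ *+ N]mulr_natr; move: (i == j)%:R q0 => t.
  by rewrite -eqq; move: N%:R => n q0; field; rewrite a0 q0.
have [BUn Uu] := mulmx1_unit BU.
split=> // n.
have -> : invmx U = B by rewrite -[LHS]mul1mx -BU -mulmxA mulmxV// mulmx1.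
rewrite mxE; under eq_bigr do rewrite mxE.
under eq_bigr do rewrite -mulrA mulrBl.
rewrite -mulr_sumr sumrB -mulr_sumr; congr (_ * (_ - _)).
rewrite (bigD1 n)//= eqxx mul1r big1 ?addr0// => k /negbTE kn.
by rewrite eq_sym kn mul0r.
Qed.

(** Summing the [d m] multiplies the sum of the [b k] by [x - y + N%:R * y], so the correction
    removes exactly the common term [y * \sum_k b k]. *)
Lemma equicorrelated_mul (x y : R) (b : 'I_N -> R) :
  x - y != 0 -> x - y + N%:R * y != 0 ->
  let d m := (x - y) * b m + y * \sum_k b k in
  forall n, (x - y)^-1 * (d n - y / (x - y + N%:R * y) * \sum_k d k) = b n.
Proof.
move=> a0 q0 d n; rewrite /d big_split /= -mulr_sumr sumr_const card_ord.
rewrite -[(y * _) *+ N]mulr_natr; move: (\sum_k b k) N%:R q0 => s t q0.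
field.
by rewrite a0 q0.
Qed.

End equicorrelated.

(** * The strong law of large numbers *)

(** Any large [n] lies between [m * 2 ^ k] and [m.+1 * 2 ^ k] with [m] between [M] and [2 * M].
    Monotonicity compares [S n] with both ends, while [mu * C] changes by at most [mu * 2 ^ k],
    hence by at most the fraction [mu / M] of [n]. *)
Lemma dyadic_interpolation (R : realType) (S C : nat -> R) (mu : R) :
  0 <= mu ->
  (forall n n', (n <= n')%N -> S n <= S n') ->
  (forall n n', (n <= n')%N -> 0 <= C n' - C n <= n'%:R - n%:R) ->
  (forall m, (0 < m)%N ->
    (fun k => (m * 2 ^ k)%:R^-1 * (S (m * 2 ^ k)%N - mu * C (m * 2 ^ k)%N))
      @ \oo --> 0) ->
  (fun n => n%:R^-1 * (S n - mu * C n)) @ \oo --> 0.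
Proof.
move=> mu0 Snd Cnd SC; apply/cvgr0Pnorm_le => e3 e30.
pose e := e3 / 3; have e0 : 0 < e by rewrite divr_gt0.
pose D n := S n - mu * C n.
pose M := (Num.truncn (mu / e)).+1.
have Me : mu <= e * M%:R by rewrite mulrC -ler_pdivrMr// ltW// truncnS_gt.
have /choice[K HK] m : exists K, forall k, (0 < m)%N -> (K <= k)%N ->
    `|D (m * 2 ^ k)%N| <= e * (m * 2 ^ k)%:R.
  have [->|m0] := posnP m; first by exists 0%N.
  have /cvgr0Pnorm_le /(_ _ e0)[k0 _ Hk0] := SC _ m0.
  exists k0 => k _ kk0; have := Hk0 _ kk0; rewrite /= normrM normfV.
  have a0 : 0 < (m * 2 ^ k)%:R :> R by rewrite ltr0n muln_gt0 m0 expn_gt0.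
  by rewrite (gtr0_norm a0) ler_pdivrMl// [_ * e]mulrC.
(* A common rank for all multipliers up to [2 * M] included, because [m.+1] can reach [2 * M]. *)
pose k0 := \max_(m < M.*2.+1) K m.
exists (M * 2 ^ k0)%N => // n /= Hn.
have n0 : (0 < n)%N by apply: leq_trans Hn; rewrite muln_gt0 expn_gt0.
pose k := trunc_log 2 (n %/ M).
have nM : (2 ^ k0 <= n %/ M)%N by rewrite leq_divRL// mulnC.
have /andP[k1 k2] : (2 ^ k <= n %/ M < 2 ^ k.+1)%N.
  by apply: trunc_log_bounds => //; apply: leq_trans nM; rewrite expn_gt0.
have k0k : (k0 <= k)%N by apply: trunc_log_max.
pose m := (n %/ 2 ^ k)%N.
have p2 : (0 < 2 ^ k)%N by rewrite expn_gt0.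
have Mk : (M * 2 ^ k <= n)%N by rewrite mulnC -leq_divRL.
have Mm : (M <= m)%N by rewrite leq_divRL.
have mM : (m < M.*2)%N.
  by rewrite ltn_divLR// -muln2 -mulnA -expnS mulnC -ltn_divLR.
have an : (m * 2 ^ k <= n)%N by apply: leq_trunc_div.
have na : (n < m.+1 * 2 ^ k)%N by apply: ltn_ceil.
have Kk i : (i < M.*2.+1)%N -> (K i <= k)%N.
  move=> iM; apply: leq_trans k0k.
  by rewrite -[i]/(nat_of_ord (Ordinal iM)) leq_bigmax.
have Da : `|D (m * 2 ^ k)%N| <= e * (m * 2 ^ k)%:R.
  apply: HK; first exact: leq_trans Mm.
  by apply: Kk; rewrite ltnW.
have Da' : `|D (m.+1 * 2 ^ k)%N| <= e * (m.+1 * 2 ^ k)%:R.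
  by apply: HK => //; apply: Kk.
have nR : 0 < n%:R :> R by rewrite ltr0n.
rewrite normrM normfV (gtr0_norm nR) ler_pdivrMl// -/(D n).
have /andP[_ C1] := Cnd _ _ an; have S1 := Snd _ _ an.
have /andP[_ C2] := Cnd _ _ (ltnW na); have S2 := Snd _ _ (ltnW na).
have gap1 : mu * (C n - C (m * 2 ^ k)%N) <= mu * (2 ^ k)%:R.
  apply: ler_wpM2l => //; apply: le_trans C1 _; rewrite lerBlDr -natrD ler_nat.
  by rewrite -[X in (X + _)%N]mul1n -mulnDl ltnW.
have gap2 : mu * (C (m.+1 * 2 ^ k)%N - C n) <= mu * (2 ^ k)%:R.
  apply: ler_wpM2l => //; apply: le_trans C2 _; rewrite lerBlDr -natrD ler_nat.
  by rewrite mulSn leq_add2l.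
have mu2k : mu * (2 ^ k)%:R <= e * n%:R.
  apply: le_trans (ler_wpM2r _ Me) _ => //.
  by rewrite -mulrA ler_pM2l// -natrM ler_nat.
have ea : e * (m * 2 ^ k)%:R <= e * n%:R by rewrite ler_pM2l// ler_nat.
have ea' : e * (m.+1 * 2 ^ k)%:R <= 2 * (e * n%:R).
  rewrite mulrCA ler_pM2l// -natrM ler_nat mulSn mul2n -addnn leq_add//.
  by rewrite (leq_trans _ Mk)// leq_pmull.
(* Of the 3, two come from the upper end, whose index is at most [2 * n], and one from the gap. *)
have -> : n%:R * e3 = 3 * (e * n%:R) by rewrite /e; field.
move: Da Da'; rewrite !ler_norml /D => /andP[d1 d2] /andP[d3 d4].
by apply/andP; split; lra.
Qed.

(** Summed over the truncation levels, second moments are controlled by the first moment. The terms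
    are [a] for levels [a <= x] and [x ^+ 2 / a] beyond: two geometric progressions. *)
Lemma dyadic_trunc_sum (R : realType) (m : nat) (x : R) K :
  (0 < m)%N -> 0 <= x ->
  \sum_(0 <= k < K) (Num.min x (m * 2 ^ k)%:R) ^+ 2 / (m * 2 ^ k)%:R <= 3 * x.
Proof.
move=> m0 x0.
(* Doubling [a] increases the potential [h] by at least the summand at [a]. *)
pose h (a : R) := if a <= x then a else 3 * x - 2 * x ^+ 2 / a.
have a0 k : 0 < (m * 2 ^ k)%:R :> R by rewrite ltr0n muln_gt0 m0 expn_gt0.
have step (a : R) : 0 < a -> (Num.min x a) ^+ 2 / a <= h (2 * a) - h a.
  move=> ap; have a2p : 0 < 2 * a by rewrite mulr_gt0.
  rewrite /h; case: (lerP a x) => ax.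
    rewrite expr2 mulfK ?gt_eqF//.
    case: (lerP (2 * a) x) => a2x; first by lra.
    (* At the crossing [a <= x < 2 * a], the claim amounts to [(2 * a - x) * (a - x) <= 0]. *)
    rewrite -[X in _ <= X](_ : 3 * x - x ^+ 2 / a - a = _); last first.
      by field; rewrite gt_eqF.
    have : x ^+ 2 / a <= 3 * x - 2 * a by rewrite ler_pdivrMr//; nra.
    lra.
  have -> : (2 * a <= x) = false by apply/negbTE; rewrite -ltNge; lra.
  rewrite -[X in _ <= X](_ : x ^+ 2 / a = _)//.
  by field; rewrite gt_eqF.
have hle (a : R) : 0 < a -> 0 <= h a <= 3 * x.
  move=> ap; rewrite /h; case: (lerP a x) => ax; first by apply/andP; split; lra.
  have q0 : 0 <= x ^+ 2 / a by rewrite divr_ge0 ?sqr_ge0// ltW.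
  have q1 : x ^+ 2 / a <= x by rewrite ler_pdivrMr//; nra.
  by rewrite -mulrA; apply/andP; split; lra.
have : \sum_(0 <= k < K) (Num.min x (m * 2 ^ k)%:R) ^+ 2 / (m * 2 ^ k)%:R
    <= h (m * 2 ^ K)%:R - h (m * 2 ^ 0)%:R.
  rewrite -(telescope_sumr (fun k => h (m * 2 ^ k)%:R))//.
  apply: ler_sum => k _; apply: le_trans (step _ (a0 k)) _.
  by rewrite expnS mulnCA (natrM _ 2).
have /andP[_ h1] := hle _ (a0 K); have /andP[h2 _] := hle _ (a0 0%N).
lra.
Qed.

(** * Integrals of bounded functions, variance bounds and almost sure convergence *)

Section slln.
Context {d : measure_display} {T : measurableType d} {R : realType}.
Variable P : probability T R.

Lemma bounded_integrable (f : T -> R) (M : R) :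
  measurable_fun setT f -> (forall x, `|f x| <= M) ->
  P.-integrable setT (EFin \o f).
Proof.
move=> mf fM.
apply: (@le_integrable _ _ _ P setT measurableT _ (EFin \o cst M)).
- exact/measurable_EFinP.
- by move=> x _; rewrite /= lee_fin (le_trans (fM x))// ler_norm.
- exact: finite_measure_integrable_cst.
Qed.

Lemma EFin_Rintegral (f : T -> R) : P.-integrable setT (EFin \o f) ->
  (\int[P]_x (f x)%:E)%E = (\int[P]_x f x)%:E.
Proof. by move=> fi; rewrite fineK// integrable_fin_num. Qed.

Definition bmfun (f : T -> R) :=
  measurable_fun setT f /\ exists M, forall x, `|f x| <= M.

Lemma bmfun_integrable f : bmfun f -> P.-integrable setT (EFin \o f).
Proof. by move=> [mf [M fM]]; exact: bounded_integrable fM. Qed.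

Lemma bmfun_cst r : bmfun (fun=> r).
Proof. by split; [exact: measurable_cst|exists `|r|]. Qed.

Lemma bmfunD f g : bmfun f -> bmfun g -> bmfun (fun x => f x + g x).
Proof.
move=> [mf [M fM]] [mg [N gN]]; split; first exact: measurable_funD.
by exists (M + N) => x; rewrite (le_trans (ler_normD _ _))// lerD.
Qed.

Lemma bmfunM f g : bmfun f -> bmfun g -> bmfun (fun x => f x * g x).
Proof.
move=> [mf [M fM]] [mg [N gN]]; split; first exact: measurable_funM.
by exists (M * N) => x; rewrite normrM ler_pM.
Qed.

Lemma bmfun_sum (I : Type) (r : seq I) (f : I -> T -> R) :
  (forall i, bmfun (f i)) -> bmfun (fun x => \sum_(i <- r) f i x).
Proof.
move=> bf; elim: r => [|i r IH].
  by under eq_fun do rewrite big_nil; exact: bmfun_cst.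
by under eq_fun do rewrite big_cons; exact: bmfunD.
Qed.

Lemma Rintegral_dominated_cvg (f_ : nat -> T -> R) (f g : T -> R) :
  (forall n, measurable_fun setT (f_ n)) ->
  (forall x, f_^~ x @ \oo --> f x) ->
  (forall n x, `|f_ n x| <= g x) ->
  P.-integrable setT (EFin \o g) -> P.-integrable setT (EFin \o f) ->
  (fun n => \int[P]_x f_ n x) @ \oo --> \int[P]_x f x.
Proof.
move=> mf_ f_f fg ig if_; apply: fine_cvg.
rewrite -EFin_Rintegral//.
apply: (@dominated_cvg _ _ _ P setT measurableT
  (fun n x => (f_ n x)%:E) _ (fun x => (g x)%:E)) => //.
- by move=> n; exact/measurable_EFinP.
- by move=> x _; apply: cvg_EFin; [exact: nearW|exact: f_f].
- by move=> n x _; rewrite lee_fin.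
Qed.

Lemma Rintegral_prob_cst (r : R) : \int[P]_x r = r.
Proof.
rewrite Rintegral_cst//.
exact: eq_trans (congr1 (fun z => r * fine z) (probability_setT P)) (mulr1 r).
Qed.

Lemma Rintegral_sum (I : Type) (r : seq I) (f : I -> T -> R) :
  (forall i, P.-integrable setT (EFin \o f i)) ->
  \int[P]_x (\sum_(i <- r) f i x) = \sum_(i <- r) \int[P]_x f i x.
Proof.
move=> fi; elim: r => [|i r IH].
  rewrite big_nil (_ : (fun x => _) = cst 0) ?Rintegral_cst ?mul0r//.
  by apply/funext => x; rewrite big_nil.
rewrite big_cons -IH -RintegralD//.
  by apply: eq_Rintegral => x _; rewrite big_cons.
rewrite (_ : EFin \o _ = (fun x => \sum_(j <- r) (EFin \o f j) x)%E).
  exact: integrable_sum.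
by apply/funext => x /=; rewrite sumEFin.
Qed.

(** After expanding the square, uncorrelated pairs vanish, and every other covariance is at most
    [s2] because [2 * Y s * Y t <= Y s ^+ 2 + Y t ^+ 2]. *)
Lemma variance_sum_le (Y : nat -> T -> R) (c : nat -> R) (k : nat) (a nu s2 : R)
    (n : nat) :
  (forall t, measurable_fun setT (Y t)) ->
  (forall t x, 0 <= Y t x <= a) ->
  (forall t, 0 <= c t <= 1) ->
  (forall t, \int[P]_x Y t x = nu) ->
  (forall t, \int[P]_x (Y t x ^+ 2) = s2) ->
  (forall s t : nat, s != t -> s != (t + k)%N -> t != (s + k)%N ->
    \int[P]_x (Y s x * Y t x) = nu ^+ 2) ->
  \int[P]_x ((\sum_(0 <= t < n) c t * (Y t x - nu)) ^+ 2) <= 3 * n%:R * s2.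
Proof.
move=> mY Ya c01 EY EY2 EYY.
have bY t : bmfun (Y t).
  by split=> //; exists a => x; have /andP[h1 h2] := Ya t x; rewrite ger0_norm.
have bYY s t : bmfun (fun x => Y s x * Y t x) by exact: bmfunM.
have bcY r t : bmfun (fun x => r * Y t x) by apply: bmfunM => //; exact: bmfun_cst.
have bYnu t : bmfun (fun x => Y t x - nu) by apply: bmfunD => //; exact: bmfun_cst.
have bC s t : bmfun (fun x => (Y s x - nu) * (Y t x - nu)) by exact: bmfunM.
have cov s t : \int[P]_x ((Y s x - nu) * (Y t x - nu)) =
    \int[P]_x (Y s x * Y t x) - nu ^+ 2.
  transitivity (\int[P]_x ((Y s x * Y t x + - nu * Y s x) +
      (- nu * Y t x + nu ^+ 2))).
    by apply: eq_Rintegral => x _; ring.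
  have b1 := bmfunD (bYY s t) (bcY (- nu) s).
  have b2 := bmfunD (bcY (- nu) t) (bmfun_cst (nu ^+ 2)).
  rewrite RintegralD ?bmfun_integrable// RintegralD ?bmfun_integrable//.
  rewrite RintegralD ?bmfun_integrable//; last exact: bmfun_cst.
  rewrite Rintegral_prob_cst.
  by rewrite !RintegralZl ?bmfun_integrable// !EY; ring.
have s20 : 0 <= s2.
  by rewrite -(EY2 0%N); apply: Rintegral_ge0 => x _; apply: sqr_ge0.
(* Each [s] is correlated with at most three indices [t], whence the 3. *)
pose bad s t := [|| s == t, s == (t + k)%N | t == (s + k)%N].
have covle s t : c s * c t * (\int[P]_x ((Y s x - nu) * (Y t x - nu)))
    <= (bad s t)%:R * s2.
  rewrite cov /bad; case: (boolP [|| _, _ | _]) => [_|]; last first.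
    by rewrite !negb_or => /and3P[h1 h2 h3]; rewrite EYY// subrr mulr0 mul0r.
  have /andP[s0 s1] := c01 s; have /andP[t0 t1] := c01 t.
  have YY : \int[P]_x (Y s x * Y t x) <= s2.
    have bY2 t' : bmfun (fun x => Y t' x ^+ 2) by exact: bYY.
    have bS : bmfun (fun x => Y s x ^+ 2 + Y t x ^+ 2) by exact: bmfunD.
    have -> : s2 = \int[P]_x (2^-1 * (Y s x ^+ 2 + Y t x ^+ 2)).
      rewrite RintegralZl ?bmfun_integrable// RintegralD ?bmfun_integrable//.
      by rewrite !EY2; field.
    apply: le_Rintegral => //; first exact: bmfun_integrable.
      by apply: bmfun_integrable; apply: bmfunM => //; exact: bmfun_cst.
    by move=> x _; have := sqr_ge0 (Y s x - Y t x); lra.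
  have cc : 0 <= c s * c t <= 1.
    by rewrite mulr_ge0//= mulr_ile1.
  have /andP[cc0 cc1] := cc; have nu2 := sqr_ge0 nu.
  (* Covariances can be negative, so the weight is bounded by 1 only after the covariance has been
     replaced by the nonnegative [s2]. *)
  rewrite mul1r (le_trans (_ : _ <= c s * c t * s2))//.
    by rewrite ler_wpM2l//; lra.
  by rewrite ler_piMl.
have -> : \int[P]_x ((\sum_(0 <= t < n) c t * (Y t x - nu)) ^+ 2) =
    \sum_(0 <= s < n) \sum_(0 <= t < n)
      c s * c t * (\int[P]_x ((Y s x - nu) * (Y t x - nu))).
  transitivity (\int[P]_x (\sum_(0 <= s < n) \sum_(0 <= t < n)
      c s * c t * ((Y s x - nu) * (Y t x - nu)))).
    apply: eq_Rintegral => x _; rewrite expr2 mulr_suml.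
    apply: eq_bigr => s _; rewrite mulr_sumr; apply: eq_bigr => t _; ring.
  have b3 s t : bmfun (fun x => c s * c t * ((Y s x - nu) * (Y t x - nu))).
    by apply: bmfunM => //; exact: bmfun_cst.
  rewrite Rintegral_sum => [|s]; last first.
    by apply: bmfun_integrable; exact: bmfun_sum.
  apply: eq_bigr => s _; rewrite Rintegral_sum => [|t]; last first.
    exact: bmfun_integrable.
  by apply: eq_bigr => t _; rewrite RintegralZl ?bmfun_integrable.
have -> : 3 * n%:R * s2 = \sum_(0 <= s < n) 3 * s2.
  by rewrite sumr_const_nat subn0 -mulr_natl; ring.
apply: ler_sum => s _.
apply: (@le_trans _ _ (\sum_(0 <= t < n) (bad s t)%:R * s2)).
  exact: ler_sum.
rewrite -mulr_suml ler_wpM2r//.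
have delta i : \sum_(0 <= t < n) (t == i)%:R <= 1 :> R.
  elim: n => [|n' IH]; first by rewrite big_geq.
  rewrite big_nat_recr//=; case: (n' =P i) => [<-|_]; last by rewrite addr0.
  rewrite big1_seq ?add0r// => t /andP[_]; rewrite mem_index_iota => /andP[_ tn].
  by rewrite ltn_eqF.
(* The case [s == t + k] is rewritten as [t == s - k]; the factor [s >= k] guards against truncated
   subtraction. *)
apply: (@le_trans _ _ (\sum_(0 <= t < n)
    ((t == s)%:R + ((s >= k)%N * (t == (s - k)%N))%:R + (t == (s + k)%N)%:R))).
  apply: ler_sum => t _; rewrite -!natrD ler_nat /bad.
  case: (s =P t) => [->|h1]; first by rewrite eqxx; lia.
  case: (s =P (t + k)%N) => [->|h2]; first by rewrite leq_addl addnK eqxx; lia.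
  by rewrite /=; lia.
rewrite !big_split/=.
have d1 := delta s; have d2 := delta (s + k)%N.
have d3 : \sum_(0 <= t < n) ((s >= k)%N * (t == (s - k)%N))%:R <= 1 :> R.
  apply: le_trans (delta (s - k)%N); apply: ler_sum => t _.
  by rewrite ler_nat; case: (k <= s)%N; rewrite ?mul1n.
lra.
Qed.
(** By monotone convergence the sum of the [Q k] has finite integral, hence is finite almost
    everywhere, and its terms tend to 0. This takes the place of Chebyshev's inequality and
    Borel-Cantelli. *)
Lemma ae_cvg0_summable (Q : nat -> T -> R) (M : R) :
  (forall k, measurable_fun setT (Q k)) -> (forall k x, 0 <= Q k x) ->
  (forall K, (\sum_(0 <= k < K) \int[P]_x (Q k x)%:E <= M%:E)%E) ->
  {ae P, forall x, Q^~ x @ \oo --> 0}.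
Proof.
move=> mQ Q0 QM; pose F x := (\sum_(0 <= k <oo) (Q k x)%:E)%E.
have mF : measurable_fun setT F.
  apply: (@ge0_emeasurable_sum _ _ _ _ (fun k x => (Q k x)%:E) xpredT).
    by move=> k x _ _; rewrite lee_fin.
  by move=> k _; exact/measurable_EFinP.
have F0 x : (0 <= F x)%E by apply: nneseries_ge0 => k _ _; rewrite lee_fin.
have iF : P.-integrable setT F.
  apply/integrableP; split=> //.
  apply: (@le_lt_trans _ _ M%:E); last exact: ltry.
  under eq_integral => x _ do rewrite gee0_abs//.
  rewrite integral_nneseries//; last 2 first.
  - by move=> k; exact/measurable_EFinP.
  - by move=> k x _; rewrite lee_fin.
  apply: lime_le; last exact: nearW.
  apply: is_cvg_nneseries => k _ _.
  by apply: integral_ge0 => x _; rewrite lee_fin.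
apply: filterS (integrable_ae measurableT iF) => x /(_ I) Ffin.
apply: cvg_series_cvg_0; apply: nondecreasing_is_cvgn.
  by apply: nondecreasing_series => k _ _.
exists (fine (F x)) => _ [n _ <-].
rewrite -lee_fin fineK// -sumEFin.
by apply: nneseries_lim_ge => k _ _; rewrite lee_fin.
Qed.

Lemma bmfun_min (X : T -> R) (a : R) : measurable_fun setT X ->
  (forall x, 0 <= X x) -> 0 <= a -> bmfun (fun x => Num.min (X x) a).
Proof.
move=> mX X0 a0; split; first exact: measurable_minr.
exists a => x; rewrite ger0_norm ?le_min ?X0//.
by rewrite ge_min lexx orbT.
Qed.

Lemma cvg_mean_min (X : T -> R) (a : nat -> R) :
  measurable_fun setT X -> (forall x, 0 <= X x) ->
  P.-integrable setT (EFin \o X) -> (forall k, 0 <= a k) -> a @ \oo --> +oo ->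
  (fun k => \int[P]_x Num.min (X x) (a k)) @ \oo --> \int[P]_x X x.
Proof.
move=> mX X0 iX a0 ay; apply: (Rintegral_dominated_cvg (g := X)) => //.
- by move=> k; have [] := bmfun_min mX X0 (a0 k).
- move=> x; apply: cvg_near_cst.
  have /cvgryPge /(_ (X x)) := ay.
  by apply: filterS => k h; rewrite min_l.
- move=> k x; rewrite ger0_norm ?le_min ?X0 ?a0//.
  by rewrite ge_min lexx.
Qed.

(** * The strong law for nonnegative terms, uncorrelated after truncation except at lags 0 and
    [k0] *)

Section slln_ge0.
Variables (X : nat -> T -> R) (c : nat -> R) (k0 : nat).
Hypothesis mX : forall t, measurable_fun setT (X t).
Hypothesis X_ge0 : forall t x, 0 <= X t x.
Hypothesis iX : P.-integrable setT (EFin \o X 0).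
Hypothesis c01 : forall t, 0 <= c t <= 1.
Hypothesis X1 : forall t a, 0 < a ->
  \int[P]_x Num.min (X t x) a = \int[P]_x Num.min (X 0 x) a.
Hypothesis X2 : forall t a, 0 < a ->
  \int[P]_x (Num.min (X t x) a ^+ 2) = \int[P]_x (Num.min (X 0 x) a ^+ 2).
Hypothesis XX : forall (s t : nat) a, 0 < a ->
  s != t -> s != (t + k0)%N -> t != (s + k0)%N ->
  \int[P]_x (Num.min (X s x) a * Num.min (X t x) a) =
  (\int[P]_x Num.min (X 0 x) a) ^+ 2.

(** Truncating at [m * 2 ^ k], which is also the number of terms, lets a single summable sequence
    [Q] control both the centred truncated sum and the event that truncation alters a term. *)
Lemma slln_dyadic m : (0 < m)%N -> {ae P, forall x,
  (fun k => (m * 2 ^ k)%:R^-1 * (\sum_(0 <= t < m * 2 ^ k) c t * X t x -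
     (\int[P]_x X 0 x) * \sum_(0 <= t < m * 2 ^ k) c t)) @ \oo --> 0}.
Proof.
move=> m0; pose n k := (m * 2 ^ k)%N; pose a k : R := (n k)%:R.
have a0 k : 0 < a k by rewrite ltr0n muln_gt0 m0 expn_gt0.
pose nu k := \int[P]_x Num.min (X 0 x) (a k).
pose s2 k := \int[P]_x (Num.min (X 0 x) (a k) ^+ 2).
pose W k x := \sum_(0 <= t < n k) c t * (Num.min (X t x) (a k) - nu k).
pose Z k x := \sum_(0 <= t < n k) Num.min (X t x) (a k) ^+ 2.
(* Where [Q k x < 1], no [X t x] with [t < n k] exceeds the truncation level. *)
pose Q k x := (a k)^-1 ^+ 2 * (W k x ^+ 2 + Z k x).
have bY t k : bmfun (fun x => Num.min (X t x) (a k)).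
  by apply: bmfun_min => //; exact: ltW.
have bY2 t k : bmfun (fun x => Num.min (X t x) (a k) ^+ 2) by exact: bmfunM.
have bW k : bmfun (fun x => W k x ^+ 2).
  rewrite /W; apply: bmfunM; apply: bmfun_sum => t;
    by apply: bmfunM; [exact: bmfun_cst|apply: bmfunD => //; exact: bmfun_cst].
have bZ k : bmfun (Z k) by exact: bmfun_sum.
have bQ k : bmfun (Q k) by apply: bmfunM; [exact: bmfun_cst|exact: bmfunD].
have Z_ge0 k x : 0 <= Z k x by apply: sumr_ge0 => t _; exact: sqr_ge0.
have Q_ge0 k x : 0 <= Q k x.
  by rewrite mulr_ge0 ?sqr_ge0// addr_ge0 ?sqr_ge0.
have EQ k : \int[P]_x Q k x <= 4 * \int[P]_x (Num.min (X 0 x) (a k) ^+ 2 / a k).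
  rewrite RintegralZl//; last exact: bmfun_integrable (bmfunD (bW k) (bZ k)).
  rewrite RintegralD//; try exact: bmfun_integrable.
  rewrite RintegralZr//; last exact: bmfun_integrable.
  rewrite Rintegral_sum; last by move=> t; exact: bmfun_integrable.
  under eq_bigr do rewrite X2//.
  rewrite sumr_const_nat subn0 -[_ *+ _]mulr_natl -/(a k) -/(s2 k).
  (* The 4 in [EQ] is 3 from the variance of [W k] plus 1 from the truncated squares in [Z k]. *)
  have : \int[P]_x (W k x ^+ 2) <= 3 * a k * s2 k.
    apply: (@variance_sum_le _ _ k0 (a k)) => //.
    - by move=> t; have [] := bY t k.
    - by move=> t x; rewrite le_min X_ge0 ltW//= ge_min lexx orbT.
    - by move=> t; rewrite X1.
    - by move=> t; rewrite X2.
    - by move=> s t *; rewrite XX.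
  move=> Wle.
  have -> : 4 * (s2 k / a k) = (a k)^-1 ^+ 2 * (4 * a k * s2 k).
    by move: (s2 k) (a k) (a0 k) => s a1 a1_gt0; field; rewrite gt_eqF.
  by rewrite ler_pM2l ?exprn_gt0 ?invr_gt0//; lra.
have Qcvg : {ae P, forall x, Q^~ x @ \oo --> 0}.
  (* The 12 is the 4 of [EQ] times the 3 of [dyadic_trunc_sum]. *)
  apply: (@ae_cvg0_summable _ (12 * \int[P]_x X 0 x)) => //.
    by move=> k; have [] := bQ k.
  move=> K; under eq_bigr do rewrite EFin_Rintegral ?bmfun_integrable//.
  rewrite sumEFin lee_fin.
  apply: (@le_trans _ _
    (\sum_(0 <= k < K) 4 * \int[P]_x (Num.min (X 0 x) (a k) ^+ 2 / a k))).
    exact: ler_sum.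
  have bg k : bmfun (fun x => Num.min (X 0 x) (a k) ^+ 2 / a k).
    by apply: bmfunM => //; exact: bmfun_cst.
  rewrite -mulr_sumr -Rintegral_sum; last by move=> k; exact: bmfun_integrable.
  rewrite (_ : 12 = 4 * 3) -?mulrA; last by ring.
  rewrite ler_pM2l// -RintegralZl//; apply: le_Rintegral => //.
  - by apply: bmfun_integrable; exact: bmfun_sum.
  - exact: (integrableZl measurableT _ iX).
  - by move=> x _; exact: dyadic_trunc_sum.
have ay : a @ \oo --> +oo.
  apply/cvgryPge => A; exists (Num.truncn A).+1 => // k /= Ak.
  apply: le_trans (ltW (truncnS_gt A)) _; rewrite ler_nat (leq_trans Ak)//.
  by rewrite (leq_trans (ltnW (ltn_expl k (ltnSn 1))))// leq_pmull.
have nucvg : nu @ \oo --> \int[P]_x X 0 x.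
  by apply: cvg_mean_min => // k; exact: ltW.
apply: filterS Qcvg => x Qx.
have Wcvg : (fun k => (a k)^-1 * W k x) @ \oo --> 0.
  apply: sqr_cvg0; apply: (squeeze_cvgr _ (cvg_cst 0) Qx).
  by apply: nearW => k; rewrite sqr_ge0 /= exprMn ler_wpM2l ?sqr_ge0// lerDl.
apply/cvgr0Pnorm_le => e e0; have e20 : 0 < e / 2 by rewrite divr_gt0.
near=> k.
have -> : \sum_(0 <= t < m * 2 ^ k) c t * X t x =
    \sum_(0 <= t < n k) c t * Num.min (X t x) (a k).
  have Q1 : Q k x < 1.
    near: k; have /cvgr0Pnorm_lt /(_ _ ltr01) := Qx.
    by apply: filterS => k; apply: le_lt_trans; exact: ler_norm.
  (* A term above the level would contribute [a k ^+ 2] to [Z k x], making [Q k x] at least 1. *)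
  apply: eq_big_nat => t /andP[_ tn]; rewrite min_l// leNgt; apply/negP => Xa.
  move: Q1; apply/negP; rewrite -leNgt.
  rewrite /Q exprVn ler_pdivlMl ?exprn_gt0// mulr1.
  apply: le_trans (_ : Z k x <= _); last by rewrite lerDr sqr_ge0.
  rewrite /Z (@big_cat_nat _ _ _ t) ?(ltnW tn)//= (big_ltn tn) min_r ?(ltW Xa)//.
  rewrite addrCA lerDl addr_ge0//; apply: sumr_ge0 => i _; exact: sqr_ge0.
(* Besides [W k x], what remains is the bias of the truncated mean times an average of weights lying
   between 0 and 1. *)
rewrite (_ : _^-1 * _ = (a k)^-1 * W k x +
    (nu k - \int[P]_x X 0 x) * ((a k)^-1 * \sum_(0 <= t < n k) c t)); last first.
  rewrite /W; under [in RHS]eq_bigr do rewrite mulrBr.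
  by rewrite sumrB -mulr_suml -/(n k) -/(a k); ring.
have c1 : `|(a k)^-1 * \sum_(0 <= t < n k) c t| <= 1.
  rewrite ger0_norm; last first.
    rewrite mulr_ge0 ?invr_ge0 ?(ltW (a0 k))//.
    by apply: sumr_ge0 => t _; have /andP[] := c01 t.
  rewrite ler_pdivrMl// mulr1.
  apply: (@le_trans _ _ (\sum_(0 <= t < n k) 1)).
    by apply: ler_sum => t _; have /andP[] := c01 t.
  by rewrite sumr_const_nat subn0.
have W1 : `|(a k)^-1 * W k x| <= e / 2.
  by near: k; have /cvgr0Pnorm_le := Wcvg; exact.
have nu1 : `|nu k - \int[P]_x X 0 x| <= e / 2.
  by near: k; have /cvgr_distC_le := nucvg; exact.
rewrite (le_trans (ler_normD _ _))// (normrM (nu k - _)).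
by rewrite [leRHS]splitr lerD// (le_trans _ nu1)// ler_piMr.
Unshelve. all: by end_near. Qed.

(** The exceptional sets, one per multiplier, are countably many; nonnegative terms make the partial
    sums monotone, as the interpolation requires. *)
Theorem slln_ge0 : {ae P, forall x,
  (fun n => n%:R^-1 * (\sum_(0 <= t < n) c t * X t x -
     (\int[P]_x X 0 x) * \sum_(0 <= t < n) c t)) @ \oo --> 0}.
Proof.
have /ae_foralln : forall m, {ae P, forall x,
  (fun k => (m.+1 * 2 ^ k)%:R^-1 * (\sum_(0 <= t < m.+1 * 2 ^ k) c t * X t x -
     (\int[P]_x X 0 x) * \sum_(0 <= t < m.+1 * 2 ^ k) c t)) @ \oo --> 0}.
  by move=> m; exact: slln_dyadic.
apply: filterS => x Hx.
apply: (@dyadic_interpolation _ (fun n => \sum_(0 <= t < n) c t * X t x)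
  (fun n => \sum_(0 <= t < n) c t)).
- by apply: Rintegral_ge0 => y _.
- move=> n n' nn'; rewrite (@big_cat_nat _ _ _ n _ n')//= lerDl.
  by apply: sumr_ge0 => t _; rewrite mulr_ge0//; have /andP[] := c01 t.
- move=> n n' nn'; rewrite (@big_cat_nat _ _ _ n _ n')//= addrAC subrr add0r.
  rewrite sumr_ge0 => [|t _]; last by have /andP[] := c01 t.
  rewrite -natrB// /= (_ : (n' - n)%:R = \sum_(n <= t < n') 1); last first.
    by rewrite sumr_const_nat.
  by apply: ler_sum => t _; have /andP[] := c01 t.
- by case=> // m _; exact: Hx.
Qed.
End slln_ge0.
End slln.

(** * Independent random variables *)

Section independence.
Context {d : measure_display} {T : measurableType d} {R : realType}.
Variable P : probability T R.

Lemma bmfun_comp (X : {RV P >-> R}) (h : R -> R) (M : R) :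
  measurable_fun setT h -> (forall y, `|h y| <= M) -> bmfun (fun x => h (X x)).
Proof. by move=> mh hM; split; [exact: measurableT_comp|exists M => x]. Qed.

Lemma bmfun_indic (X : {RV P >-> R}) (B : set R) : measurable B ->
  bmfun (fun x => \1_B (X x) : R).
Proof.
move=> mB; apply: (@bmfun_comp _ _ 1); first exact: measurable_indic.
by move=> y; rewrite indicE; case: (_ \in _); rewrite ?normr1 ?normr0.
Qed.

Import HBNNSimple.

(** Linearity extends the product rule from indicators to simple functions, and dominated
    convergence extends it to bounded [h], approximated from below. *)
Lemma indep_bounded (X : {RV P >-> R}) (W : T -> R) (h : R -> R) (M : R) :
  bmfun W ->
  (forall B, measurable B -> \int[P]_x (\1_B (X x) * W x) =
     \int[P]_x \1_B (X x) * \int[P]_x W x) ->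
  measurable_fun setT h -> (forall y, 0 <= h y <= M) ->
  \int[P]_x (h (X x) * W x) = \int[P]_x h (X x) * \int[P]_x W x.
Proof.
move=> bW XW mh hM.
have mhE : measurable_fun setT (EFin \o h) by exact/measurable_EFinP.
pose s n := nnsfun_approx measurableT mhE n.
have h0 y : [set: R] y -> (0 <= (EFin \o h) y)%E.
  by rewrite /= lee_fin => _; have /andP[] := hM y.
have s_h n y : s n y <= h y.
  by rewrite /s nnsfun_approxE -lee_fin; exact: le_approx.
have s_cvg y : (fun n => s n y) @ \oo --> h y.
  exact: (fine_cvg (cvg_nnsfun_approx measurableT mhE h0 (I : setT y))).
have sM n y : `|s n y| <= M.
  by rewrite ger0_norm// (le_trans (s_h _ _))//; have /andP[] := hM y.
have bs n : bmfun (fun x => s n (X x)) by apply: bmfun_comp (sM n).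
have bh : bmfun (fun x => h (X x)).
  apply: (@bmfun_comp _ _ M) => // y.
  by have /andP[? ?] := hM y; rewrite ger0_norm.
have sW n : \int[P]_x (s n (X x) * W x) = \int[P]_x s n (X x) * \int[P]_x W x.
  pose F r x := r * \1_(s n @^-1` [set r]) (X x).
  have [l sE] : exists l : seq R, forall x, s n (X x) = \sum_(r <- l) F r x.
    by eexists => x; rewrite fimfunE fsbig_finite.
  have bi r : bmfun (fun x => \1_(s n @^-1` [set r]) (X x) : R).
    by apply: bmfun_indic; exact: measurable_funPTI.
  have bF r : bmfun (F r) by apply: bmfunM; [exact: bmfun_cst|exact: bi].
  transitivity (\int[P]_x (\sum_(r <- l) F r x * W x)).
    by apply: eq_Rintegral => x _; rewrite sE mulr_suml.
  transitivity ((\int[P]_x (\sum_(r <- l) F r x))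
      * \int[P]_x W x); last first.
    by congr (_ * _); apply: eq_Rintegral => x _; rewrite sE.
  rewrite !Rintegral_sum; [|by move=> r; exact: bmfun_integrable
    |by move=> r; apply: bmfun_integrable; exact: bmfunM].
  rewrite mulr_suml; apply: eq_bigr => r _.
  rewrite /F RintegralZl//; last exact: bmfun_integrable.
  under eq_Rintegral do rewrite -mulrA.
  rewrite RintegralZl//; last by apply: bmfun_integrable; exact: bmfunM.
  by rewrite XW ?mulrA//; exact: measurable_funPTI.
have [mW [K WK]] := bW.
have M0 : 0 <= M by have /andP[a b] := hM 0; exact: le_trans b.
have c1 : (fun n => \int[P]_x (s n (X x) * W x)) @ \oo -->
    \int[P]_x (h (X x) * W x).
  apply: (Rintegral_dominated_cvg (g := fun=> M * K)).
  - by move=> n; have [] := bmfunM (bs n) bW.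
  - by move=> x; apply: cvgM; [exact: s_cvg|exact: cvg_cst].
  - by move=> n x; rewrite normrM ler_pM.
  - exact: bmfun_integrable (bmfun_cst _).
  - exact: bmfun_integrable (bmfunM bh bW).
have c2 : (fun n => \int[P]_x s n (X x)) @ \oo --> \int[P]_x h (X x).
  apply: (Rintegral_dominated_cvg (g := fun=> M)) => //.
  - by move=> n; have [] := bs n.
  - exact: bmfun_integrable (bmfun_cst _).
  - exact: bmfun_integrable.
move: c1; rewrite (funext sW) => c1; apply: (cvg_unique _ c1) => //.
by apply: cvgM => //; exact: cvg_cst.
Qed.

Lemma Rintegral_indic_comp (X : {RV P >-> R}) (B : set R) : measurable B ->
  \int[P]_x \1_B (X x) = fine (P (X @^-1` B)).
Proof.
move=> mB; rewrite /Rintegral -[X @^-1` B]setIT -integral_indic//.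
exact: measurable_funPTI.
Qed.

(** Independence is given for events only. It passes to functions through mixed products of
    functions and indicators, [indep_bounded] upgrading one factor at a time. *)
Lemma Rintegral_indep_prod (I : eqType) (X : I -> {RV P >-> R})
    (f : I -> R -> R) (M : R) (s : seq I) :
  mutually_independent X -> uniq s ->
  (forall i, measurable_fun setT (f i)) -> (forall i y, 0 <= f i y <= M) ->
  \int[P]_x (\prod_(i <- s) f i (X i x)) = \prod_(i <- s) \int[P]_x f i (X i x).
Proof.
move=> XI us mf fM.
have bf i : bmfun (fun x => f i (X i x)).
  apply: (@bmfun_comp _ _ M) => // y.
  by have /andP[? ?] := fM i y; rewrite ger0_norm.
have bprod (s' : seq I) (F : I -> T -> R) : (forall i, i \in s' -> bmfun (F i)) ->
    bmfun (fun x => \prod_(i <- s') F i x).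
  elim: s' => [_|i s' IH bF].
    by under eq_fun do rewrite big_nil; exact: bmfun_cst.
  under eq_fun do rewrite big_cons; apply: bmfunM.
    by apply: bF; rewrite mem_head.
  by apply: IH => j js; apply: bF; rewrite in_cons js orbT.
(* Indicators are replaced by the functions [f i] one index at a time. *)
suff key (s1 s2 : seq I) (B : I -> set R) : uniq (s1 ++ s2) ->
    (forall i, i \in s2 -> measurable (B i)) ->
    \int[P]_x ((\prod_(i <- s1) f i (X i x)) * \prod_(i <- s2) \1_(B i) (X i x))
    = (\prod_(i <- s1) \int[P]_x f i (X i x)) *
      \prod_(i <- s2) \int[P]_x \1_(B i) (X i x).
  have := key s [::] (fun=> setT); rewrite cats0 big_nil mulr1 => <- //.
  by apply: eq_Rintegral => x _; rewrite big_nil mulr1.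
elim: s1 s2 B => [|i s1 IH] s2 B us12 mB.
  rewrite big_nil mul1r.
  transitivity (fine (P (\big[setI/setT]_(i <- s2) (X i @^-1` B i)))).
    rewrite -[X in P X]setIT -integral_indic//; last first.
      rewrite big_seq; apply: big_ind => //; first exact: measurableI.
      by move=> i is2; apply: measurable_funPTI; exact: mB.
    apply: eq_Rintegral => x _; rewrite big_nil mul1r.
    elim: (s2) => [|i s' IH]; first by rewrite !big_nil indicT.
    by rewrite !big_cons IH indicI.
  rewrite XI//=; apply: eq_big_seq => i /mB mBi.
  by rewrite Rintegral_indic_comp.
pose W x :=
  (\prod_(j <- s1) f j (X j x)) * \prod_(j <- s2) \1_(B j) (X j x) : R.
have /= /andP[is12 us12'] := us12.
have bW : bmfun W.
  apply: bmfunM; first by apply: bprod => j _; exact: bf.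
  by apply: bprod => j js; apply: bmfun_indic; exact: mB.
transitivity (\int[P]_x (f i (X i x) * W x)).
  by apply: eq_Rintegral => x _; rewrite big_cons mulrA.
rewrite big_cons -mulrA -IH// -/(W _).
apply: (@indep_bounded _ _ _ M) => // A mA.
(* Index [i] joins the indicator list with test set [A]; as [i] is not in [s2], the other sets are
   unchanged. *)
pose B' j := if j == i then A else B j.
have B'i : B' i = A by rewrite /B' eqxx.
have B'E j : j \in s2 -> B' j = B j.
  rewrite /B'; case: eqP => // -> is2.
  by move: is12; rewrite mem_cat is2 orbT.
have := IH (i :: s2) B'.
rewrite -cat_rcons -cats1 -catA uniq_catCA /= is12 us12' => /(_ isT).
have mB' j : j \in i :: s2 -> measurable (B' j).
  by rewrite in_cons /B'; case: eqP => //= _ js; exact: mB.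
move=> /(_ mB'); rewrite big_cons B'i.
have -> : \prod_(j <- s2) \int[P]_x \1_(B' j) (X j x) =
    \prod_(j <- s2) \int[P]_x \1_(B j) (X j x).
  by apply: eq_big_seq => j /B'E ->.
rewrite mulrCA -IH// -/(W _) => <-.
apply: eq_Rintegral => x _; rewrite big_cons B'i mulrCA.
congr (_ * (_ * _)); apply: eq_big_seq => j /B'E.
by move=> ->.
Qed.

Lemma ident_ge0_integral (X Y : {RV P >-> R}) (f : R -> R) :
  (forall B, measurable B -> P (X @^-1` B) = P (Y @^-1` B)) ->
  measurable_fun setT f -> (forall y, 0 <= f y) ->
  (\int[P]_x (f (X x))%:E = \int[P]_x (f (Y x))%:E)%E.
Proof.
move=> XY mf f0.
have mfE : measurable_fun setT (EFin \o f) by exact/measurable_EFinP.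
have f0E y : (0 <= (EFin \o f) y)%E by rewrite lee_fin.
have := ge0_integral_distribution X mfE f0E.
have := ge0_integral_distribution Y mfE f0E.
rewrite /comp => <- <-.
by apply: eq_measure_integral => B mB _; exact: XY.
Qed.

Lemma ident_integral (X Y : {RV P >-> R}) (f : R -> R) :
  (forall B, measurable B -> P (X @^-1` B) = P (Y @^-1` B)) ->
  measurable_fun setT f -> (forall y, 0 <= f y) ->
  \int[P]_x f (X x) = \int[P]_x f (Y x).
Proof. by move=> XY mf f0; rewrite /Rintegral (ident_ge0_integral XY). Qed.

Lemma ident_integrable (X Y : {RV P >-> R}) (f : R -> R) :
  (forall B, measurable B -> P (X @^-1` B) = P (Y @^-1` B)) ->
  measurable_fun setT f ->
  P.-integrable setT (EFin \o (fun x => f (Y x))) ->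
  P.-integrable setT (EFin \o (fun x => f (X x))).
Proof.
move=> XY mf /integrableP[_ fY]; apply/integrableP; split.
  by apply/measurable_EFinP; exact: measurableT_comp.
apply: le_lt_trans fY; rewrite le_eqVlt; apply/orP; left; apply/eqP.
apply: (ident_ge0_integral (f := fun y => `|f y|)) XY _ _ => //.
exact: measurableT_comp.
Qed.
End independence.

(** * The strong law for products of an indicator and an independent factor *)

Section slln_indep.
Context {d : measure_display} {T : measurableType d} {R : realType}.
Variables (P : probability T R) (I : eqType) (X : I -> {RV P >-> R}).
Variables (Xi Xj : {RV P >-> R}).
Variables (i j : nat -> I) (k0 : nat) (c : nat -> R) (A : set R).
Hypothesis XI : mutually_independent X.
Hypothesis uniq_ij : forall s t : nat,
  s != t -> s != (t + k0)%N -> t != (s + k0)%N -> uniq [:: i s; j s; i t; j t].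
Hypothesis ident_i : forall t B, measurable B ->
  P (X (i t) @^-1` B) = P (Xi @^-1` B).
Hypothesis ident_j : forall t B, measurable B ->
  P (X (j t) @^-1` B) = P (Xj @^-1` B).
Hypothesis mA : measurable A.
Hypothesis c01 : forall t, 0 <= c t <= 1.

Let p := fine (P (Xi @^-1` A)).

Let ind01 (y : R) : 0 <= (\1_A y : R) <= 1.
Proof. by rewrite indicE; case: (_ \in _); rewrite /= ?lexx ?ler01. Qed.

Let mean_indic t : \int[P]_x \1_A (X (i t) x) = p.
Proof. by rewrite Rintegral_indic_comp// ident_i. Qed.

Let mean_prod t (h : R -> R) (M : R) :
  measurable_fun setT h -> (forall y, 0 <= h y <= M) ->
  \int[P]_x (\1_A (X (i t) x) * h (X (j t) x)) = p * \int[P]_x h (Xj x).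
Proof.
move=> mh hM.
have : uniq [:: i t; j t].
  (* A time far enough from [t] is paired with it, so that the hypothesis on four indices separates
     [i t] from [j t]. *)
  have /= : uniq [:: i (t + k0).+1; j (t + k0).+1; i t; j t].
    by apply: uniq_ij; lia.
  by move=> /andP[_ /andP[_]].
rewrite /= inE andbT => ij.
pose f k := if k == i t then \1_A else h.
have /= := @Rintegral_indep_prod _ _ _ P _ X f (Num.max 1 M) [:: i t; j t] XI.
rewrite !big_cons !big_nil /f eqxx [j t == _]eq_sym (negbTE ij) !mulr1.
rewrite mean_indic.
rewrite (@ident_integral _ _ _ _ _ Xj h) => [<- //|||]; first last.
- by move=> y; have /andP[] := hM y.
- by [].
- exact: ident_j.
- move=> k y; case: ifP => _.
    by have /andP[-> h1] := ind01 y; rewrite /= le_max h1.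
  by have /andP[-> h1] := hM y; rewrite /= le_max h1 orbT.
- by move=> k; case: ifP => _ //; exact: measurable_indic.
- by rewrite /= inE ij.
by apply: eq_Rintegral => x _; rewrite !big_cons !big_nil eqxx [j t == _]eq_sym
  (negbTE ij) !mulr1.
Qed.

Let mean_prod2 s t (h : R -> R) (M : R) :
  measurable_fun setT h -> (forall y, 0 <= h y <= M) ->
  s != t -> s != (t + k0)%N -> t != (s + k0)%N ->
  \int[P]_x ((\1_A (X (i s) x) * h (X (j s) x)) *
             (\1_A (X (i t) x) * h (X (j t) x))) =
  (p * \int[P]_x h (Xj x)) ^+ 2.
Proof.
move=> mh hM st1 st2 st3; have us := uniq_ij st1 st2 st3.
pose f k := if k \in [:: i s; i t] then \1_A else h.
have fi : (f (i s) = \1_A) * (f (i t) = \1_A).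
  by rewrite /f !inE !eqxx orbT.
have fj : (f (j s) = h) * (f (j t) = h).
  move: us; rewrite /= !inE !negb_or.
  move=> /and4P[/and3P[a1 a2 a3] /andP[a4 a5] a6 _].
  by rewrite /f !inE ![j _ == _]eq_sym (negbTE a1) (negbTE a3) [i t == _]eq_sym
    (negbTE a4) (negbTE a6).
have ihj t' : \int[P]_x h (X (j t') x) = \int[P]_x h (Xj x).
  by apply: ident_integral => // [B|y]; [exact: ident_j|have /andP[] := hM y].
have := @Rintegral_indep_prod _ _ _ P _ X f (Num.max 1 M) _ XI us.
rewrite !big_cons !big_nil !fi !fj !mulr1 !mean_indic !ihj => E.
rewrite expr2 -mulrA -E.
- apply: eq_Rintegral => x _.
  by rewrite !big_cons !big_nil !fi !fj mulr1 !mulrA.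
- by move=> k; rewrite /f; case: ifP => _ //; exact: measurable_indic.
- move=> k y; rewrite /f; case: ifP => _.
    by have /andP[-> h1] := ind01 y; rewrite /= le_max h1.
  by have /andP[-> h1] := hM y; rewrite /= le_max h1 orbT.
Qed.

(** Truncation at a positive level commutes with multiplication by an indicator, so truncated
    products keep their form with [g] replaced by a bounded function, and their moments factor by
    independence. *)
Lemma slln_indep_ge0 (g : R -> R) :
  measurable_fun setT g -> (forall y, 0 <= g y) ->
  P.-integrable setT (EFin \o (fun x => g (Xj x))) ->
  {ae P, forall x, (fun n => n%:R^-1 *
    (\sum_(0 <= t < n) c t * (\1_A (X (i t) x) * g (X (j t) x)) -
     (p * \int[P]_x g (Xj x)) * \sum_(0 <= t < n) c t)) @ \oo --> 0}.
Proof.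
move=> mg g0 ig.
pose Z t x := \1_A (X (i t) x) * g (X (j t) x).
have mgX t : measurable_fun setT (fun x => g (X (j t) x)).
  exact: measurableT_comp.
have mZ t : measurable_fun setT (Z t).
  by apply: measurable_funM => //; have [] := bmfun_indic (X (i t)) mA.
have Z0 t x : 0 <= Z t x.
  by rewrite mulr_ge0//; have /andP[] := ind01 (X (i t) x).
have iZ : P.-integrable setT (EFin \o Z 0%N).
  have igj := ident_integrable (ident_j 0) mg ig.
  apply: (le_integrable measurableT _ _ igj); first exact/measurable_EFinP.
  move=> x _; rewrite /= lee_fin (ger0_norm (Z0 _ _)) (ger0_norm (g0 _)).
  by rewrite /Z ler_piMl.
pose h a y := Num.min (g y) a.
have mh a : measurable_fun setT (h a) by exact: measurable_minr.
have ha a y : 0 < a -> 0 <= h a y <= a.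
  by move=> a0; rewrite le_min g0 (ltW a0)/= ge_min lexx orbT.
have minZ t x a : 0 < a ->
    Num.min (Z t x) a = \1_A (X (i t) x) * h a (X (j t) x).
  move=> a0; rewrite /Z indicE; case: (_ \in _); rewrite ?mul1r// !mul0r.
  by rewrite min_l// ltW.
have Z1 t a : 0 < a ->
    \int[P]_x Num.min (Z t x) a = p * \int[P]_x h a (Xj x).
  move=> a0; under eq_Rintegral do rewrite minZ//.
  by apply: (@mean_prod _ _ a) => // y; exact: ha.
have Z2 t a : 0 < a -> \int[P]_x (Num.min (Z t x) a ^+ 2) =
    p * \int[P]_x (h a (Xj x) ^+ 2).
  move=> a0; rewrite -(@mean_prod t (fun y => h a y ^+ 2) (a ^+ 2)).
  - apply: eq_Rintegral => x _; rewrite minZ// exprMn; congr (_ * _).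
    by rewrite indicE; case: (_ \in _); rewrite ?expr1n ?expr0n.
  - exact: measurable_funX.
  - move=> y; have /andP[h0 h1] := ha _ y a0.
    by rewrite sqr_ge0 lerXn2r// nnegrE// ltW.
(* The product rule is available for bounded functions, so the mean of the product is reached as a
   limit of truncated means. *)
have EZ : \int[P]_x Z 0%N x = p * \int[P]_x g (Xj x).
  have ny : (fun k => k.+1%:R : R) @ \oo --> +oo.
    apply/cvgryPge => a; exists (Num.truncn a) => // k /= ak.
    by apply: le_trans (ltW (truncnS_gt a)) _; rewrite ler_nat.
  have z1 := cvg_mean_min (mZ 0%N) (Z0 0%N) iZ (fun k => ler0n R k.+1) ny.
  have mgXj : measurable_fun setT (fun x => g (Xj x)).
    exact: measurableT_comp.
  have z2 := cvg_mean_min mgXj (fun x => g0 _) ig (fun k => ler0n R k.+1) ny.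
  apply: (cvg_unique _ z1) => //.
  rewrite (_ : (fun k => _) =
    (fun k => p * \int[P]_x Num.min (g (Xj x)) k.+1%:R)).
    by apply: cvgM => //; exact: cvg_cst.
  by apply/funext => k; rewrite Z1.
rewrite -EZ; apply: (@slln_ge0 _ _ _ _ Z c k0) => //.
- by move=> t a a0; rewrite !Z1.
- by move=> t a a0; rewrite !Z2.
- move=> s t a a0 st1 st2 st3; rewrite Z1//.
  rewrite -(@mean_prod2 s t (h a) a)// => [|y]; last exact: ha.
  by apply: eq_Rintegral => x _; rewrite !minZ.
Qed.

(** The positive and negative parts of [g] are functions of the same variable, so the nonnegative
    case applies to each. *)
Theorem slln_indep (g : R -> R) :
  measurable_fun setT g ->
  P.-integrable setT (EFin \o (fun x => g (Xj x))) ->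
  {ae P, forall x, (fun n => n%:R^-1 *
    (\sum_(0 <= t < n) c t * (\1_A (X (i t) x) * g (X (j t) x)) -
     (p * \int[P]_x g (Xj x)) * \sum_(0 <= t < n) c t)) @ \oo --> 0}.
Proof.
move=> mg ig.
have ip := integrable_funrpos measurableT ig.
have iN := integrable_funrneg measurableT ig.
have := slln_indep_ge0 (measurable_funrneg mg) (funrneg_ge0 g) iN.
have := slln_indep_ge0 (measurable_funrpos mg) (funrpos_ge0 g) ip.
apply: filterS2 => x Hp Hn.
have gE y : g y = g^\+ y - g^\- y by rewrite -[in LHS](funrposBneg g).
apply: (cvgB0 Hp Hn) => n; rewrite -mulrBr; congr (_ * _).
have -> : \int[P]_x g (Xj x) =
   \int[P]_x g^\+ (Xj x) - \int[P]_x g^\- (Xj x).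
  by rewrite -RintegralB//; apply: eq_Rintegral => y _; exact: gE.
under [X in X - _ = _]eq_bigr do rewrite gE !mulrBr.
by rewrite sumrB; ring.
Qed.

End slln_indep.

(** [K n] differs from [p * C n] by o(n), hence eventually exceeds half of [p * c * n]. Replacing
    [p * C n] by [K n] in the first limit costs a multiple of the second. *)
Lemma weighted_ratio_cvg (R : realType) (S K C : nat -> R) (p r c : R) :
  0 < p -> 0 < c -> (forall n, c * n%:R <= C n) ->
  (fun n => n%:R^-1 * (S n - p * r * C n)) @ \oo --> 0 ->
  (fun n => n%:R^-1 * (K n - p * C n)) @ \oo --> 0 ->
  (\forall n \near \oo, p * c / 2 * n%:R <= K n) /\
  (fun n => (K n)^-1 * S n) @ \oo --> r.
Proof.
move=> p0 c0 Cc SC KC.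
have pc0 : 0 < p * c / 2 by rewrite divr_gt0// mulr_gt0.
have Kn : \forall n \near \oo, p * c / 2 * n%:R <= K n.
  have /cvgr0Pnorm_le /(_ _ pc0) KC' := KC.
  near=> n.
  have n0 : 0 < n%:R :> R by rewrite ltr0n; near: n; exists 1%N.
  have : `|n%:R^-1 * (K n - p * C n)| <= p * c / 2 by near: n.
  rewrite normrM normfV (gtr0_norm n0) ler_pdivrMl// ler_norml => /andP[h _].
  have := ler_wpM2l (ltW p0) (Cc n); lra.
split=> //; apply: ratio_cvg pc0 Kn _.
rewrite (_ : (fun n => _) = (fun n => n%:R^-1 * (S n - p * r * C n)
    - r * (n%:R^-1 * (K n - p * C n)))); last by apply/funext => n; ring.
rewrite -(subr0 0) -[X in _ - X](mulr0 r); apply: cvgB => //.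
by apply: cvgM => //; exact: cvg_cst.
Unshelve. all: by end_near. Qed.

(** * Convergence of the estimator *)

Definition admissible (N t : nat) := (0 < t %% N.+2 <= N)%N.

(** If the bound is tight at [n], then [n] is a multiple of [N.+2], so [n.+1] has residue 1 and the
    count grows. Admissible times thus have positive lower density. *)
Lemma count_admissible N n : (0 < N)%N ->
  (n <= N.+2 * count_upto (admissible N) n)%N.
Proof.
move=> N0; elim: n => // n IH; rewrite count_uptoS.
case: (boolP (admissible N n.+1)) => adm; first by rewrite addn1 mulnS; lia.
rewrite addn0 ltn_neqAle IH andbT; apply: contra adm => /eqP nE.
have /eqP n0 : (N.+2 %| n)%N by rewrite nE dvdn_mulr.
by rewrite /admissible -[n.+1]addn1 -modnDml n0 modn_small.
Qed.

Lemma natr_count (R : pzSemiRingType) (p : nat -> bool) n :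
  (count_upto p n)%:R = \sum_(1 <= t < n.+1) (p t)%:R :> R.
Proof. by rewrite /count_upto natr_sum. Qed.

(** * Pathwise argument: from limits of averages to the estimator *)

Section deterministic.
Variables (R : realType) (N : nat) (b : 'I_N -> R) (cu : R) (alpha : nat -> R).
Variables (U W : int -> R) (M K p : R).
Hypothesis N_gt0 : (0 < N)%N.
Hypothesis p_gt0 : 0 < p.
Hypothesis alpha_gt0 : forall j, (0 < j)%N -> 0 < alpha j.
Hypothesis alpha_div : series (fun j => alpha j.+1) @ \oo --> +oo.
Hypothesis alpha_sqr : cvg (series (fun j => alpha j.+1 ^+ 2) @ \oo).

Let above t := cu < U t%:Z.
Let adm t := admissible N t.

Hypothesis U_avg :
  (fun n => n%:R^-1 * (\sum_(1 <= t < n.+1) U t%:Z - M * n%:R)) @ \oo --> 0.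
Hypothesis above_avg : (fun n => n%:R^-1 *
  (\sum_(1 <= t < n.+1) (above t)%:R - p * n%:R)) @ \oo --> 0.
Hypothesis U_above_avg : (fun n => n%:R^-1 *
  (\sum_(1 <= t < n.+1) (above t)%:R * U t%:Z - p * K * n%:R)) @ \oo --> 0.
Hypothesis adm_above_avg : (fun n => n%:R^-1 *
  (\sum_(1 <= t < n.+1) (adm t)%:R * (above t)%:R
   - p * \sum_(1 <= t < n.+1) (adm t)%:R)) @ \oo --> 0.
Hypothesis y_avg : forall m : 'I_N, (fun n => n%:R^-1 *
  (\sum_(1 <= t < n.+1) (adm t)%:R * ((above t)%:R * fir_y b U W (t + m.+1)%:Z)
   - p * ((K - M) * b m + M * \sum_k b k) * \sum_(1 <= t < n.+1) (adm t)%:R))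
  @ \oo --> 0.

Let pick_time t := [&& (0 < t %% N.+2)%N, (t %% N.+2 <= N)%N & cu < U t%:Z].

Let pick_timeE t : (pick_time t)%:R = (adm t)%:R * (above t)%:R :> R.
Proof. by rewrite -natrM mulnb /pick_time andbA. Qed.

Let ratio_above :
  (fun n => (\sum_(1 <= t < n.+1) (above t)%:R)^-1 *
    \sum_(1 <= t < n.+1) (above t)%:R * U t%:Z) @ \oo --> K.
Proof.
have lb n : 1 * n%:R <= n%:R :> R by rewrite mul1r.
by have [] := weighted_ratio_cvg p_gt0 ltr01 lb U_above_avg above_avg.
Qed.

Let adm_lb n : N.+2%:R^-1 * n%:R <= \sum_(1 <= t < n.+1) (adm t)%:R :> R.
Proof.
by rewrite -natr_count ler_pdivrMl// -natrM ler_nat count_admissible.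
Qed.

Let ratio_pick (m : 'I_N) :
  (\forall n \near \oo, p * N.+2%:R^-1 / 2 * n%:R <=
    \sum_(1 <= t < n.+1) (adm t)%:R * (above t)%:R) /\
  (fun n => (\sum_(1 <= t < n.+1) (adm t)%:R * (above t)%:R)^-1 *
    \sum_(1 <= t < n.+1)
      (adm t)%:R * ((above t)%:R * fir_y b U W (t + m.+1)%:Z)) @ \oo -->
  (K - M) * b m + M * \sum_k b k.
Proof.
by apply: weighted_ratio_cvg p_gt0 _ adm_lb (y_avg m) adm_above_avg; rewrite invr_gt0.
Qed.

(** The selected times have positive lower density, so [tau] never falls back on the default of
    [nth_time]. *)
Let pick_unbounded i : exists t, (i <= count_upto pick_time t)%N.
Proof.
have [+ _] := ratio_pick (Ordinal N_gt0).
set c := _ / 2; have c0 : 0 < c.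
  by rewrite /c divr_gt0// mulr_gt0// invr_gt0.
move=> [n0 _ Hn0]; pose n := maxn n0 (Num.truncn (i%:R / c)).+1.
exists n; rewrite -(ler_nat R) natr_count.
have /= := Hn0 n (leq_maxl _ _); under eq_bigr do rewrite -pick_timeE.
apply: le_trans; rewrite -ler_pdivrMl// mulrC.
by rewrite (le_trans (ltW (truncnS_gt _)))// ler_nat leq_maxr.
Qed.

Let sjN j : sj N cu U j = nth_time pick_time (N * j). Proof. by []. Qed.

Let sj_ge j : (j <= sj N cu U j)%N.
Proof.
by rewrite sjN (leq_trans _ (nth_time_ge (pick_unbounded _)))// leq_pmull.
Qed.

Let cvg_sj (v : nat -> R) (l : R) :
  v @ \oo --> l -> (fun j => v (sj N cu U j)) @ \oo --> l.
Proof.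
move=> vl; apply: (cvg_comp _ _ _ vl) => A [n0 _ Hn0]; exists n0 => // j /= nj.
by apply: Hn0 => /=; rewrite (leq_trans nj)// sj_ge.
Qed.

Let e1_cvg : (fun j => e1 U (sj N cu U j)) @ \oo --> M.
Proof.
apply: cvg_sj; apply/cvgrPdist_le => e e0.
have /cvgr0Pnorm_le /(_ _ e0) [n0 _ Hn0] := U_avg.
exists n0.+1 => // n /= nn0; have := Hn0 n (ltnW nn0).
rewrite /= distrC mulrBr mulrCA mulVf ?mulr1 ?pnatr_eq0//.
by case: n nn0.
Qed.

Let e2_cvg : (fun j => e2 cu U (kj N cu U j)) @ \oo --> K.
Proof.
apply: eq_cvgn (cvg_sj ratio_above) => j; apply/esym.
rewrite /e2 /kj /tk (sum_nth_time _ (fun t => U t%:Z)) natr_count [X in _ * X = _]big_mkcond.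
congr (_^-1 * _); apply: eq_bigr => // t _; rewrite /above.
by case: ifP => _; rewrite ?mul1r ?mul0r.
Qed.

(** At time [sj j] exactly [N * j] selected times have occurred, so the average is a ratio of two
    sums up to [sj j]. *)
Let dd_cvg (m : 'I_N) : (fun j => dd b cu U W m (N * j)) @ \oo -->
  (K - M) * b m + M * \sum_k b k.
Proof.
have [_ /cvg_sj h] := ratio_pick m; apply: eq_cvgn h => j; apply/esym.
rewrite /dd /tau -/pick_time.
have cE : (N * j)%N = count_upto pick_time (sj N cu U j).
  by rewrite sjN count_nth_time.
rewrite cE (sum_nth_time _ (fun t => fir_y b U W (t + m.+1)%:Z)).
rewrite natr_count [X in _ * X = _]big_mkcond.
congr (_^-1 * _); apply: eq_bigr => t _; first by rewrite pick_timeE.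
by rewrite mulrA -pick_timeE; case: ifP => _; rewrite ?mul1r ?mul0r.
Qed.

Let alpha_cvg0 : (fun j => alpha j.+1) @ \oo --> 0.
Proof. by apply: sqr_cvg0; exact: cvg_series_cvg_0. Qed.

(** The closed form of the solution is continuous where [K - M] and [K - M + N%:R * M] are nonzero,
    which is what the two conditions on [K] say. *)
Lemma bhat_cvg : K != M -> K != (1 - N%:R) * M ->
  forall n : 'I_N, (fun j => bhat b cu alpha U W j n ord0) @ \oo --> b n.
Proof.
move=> KM KNM n.
have a0 : K - M != 0 by rewrite subr_eq0.
have q0 : K - M + N%:R * M != 0.
  by move: KNM; rewrite -subr_eq0; congr (_ != _); ring.
have h1 : (fun j => e1hat N cu alpha U j) @ \oo --> M.
  exact: sign_rec_cvg.
have h2 : (fun j => e2hat N cu alpha U j) @ \oo --> K.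
  exact: sign_rec_cvg.
have hd m : (fun j => dhat b cu alpha U W m j) @ \oo -->
    (K - M) * b m + M * \sum_k b k.
  by apply: sign_rec_cvg => //; exact: dd_cvg.
pose a j := e2hat N cu alpha U j - e1hat N cu alpha U j.
pose q j := a j + N%:R * e1hat N cu alpha U j.
have ha : a @ \oo --> K - M by apply: cvgB.
have hq : q @ \oo --> K - M + N%:R * M.
  by apply: cvgD => //; apply: cvgM => //; exact: cvg_cst.
have hs : (fun j => \sum_k dhat b cu alpha U W k j) @ \oo -->
    \sum_k ((K - M) * b k + M * \sum_k b k).
  by apply: cvg_sumn => m; exact: hd.
rewrite -(equicorrelated_mul b a0 q0 n).
have h : (fun j => (a j)^-1 * (dhat b cu alpha U W n j -
   e1hat N cu alpha U j / q j * \sum_k dhat b cu alpha U W k j)) @ \oo -->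
  (K - M)^-1 * ((K - M) * b n + M * (\sum_k b k) - M / (K - M + N%:R * M) *
   \sum_k ((K - M) * b k + M * \sum_k b k)).
  apply: cvgM; first exact: cvgV.
  apply: cvgB; first exact: hd.
  by apply: cvgM => //; apply: cvgM => //; exact: cvgV.
(* The closed form is known to equal [bhat] only once both denominators are nonzero; before that
   [Umat] may be singular and [bhat] be 0. *)
apply: cvg_trans h; apply: near_eq_cvg; near=> j.
have aj : a j != 0 by near: j; exact: cvgr_neq0 ha a0.
have qj : q j != 0 by near: j; exact: cvgr_neq0 hq q0.
have [Uu UE] := equicorrelated_solve (\col_m dhat b cu alpha U W m j) aj qj.
rewrite /bhat /Umat Uu UE !mxE; congr (_ * (_ - _ * _)).
by apply: eq_bigr => m _; rewrite mxE.
Unshelve. all: by end_near. Qed.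
End deterministic.

(** * Almost sure limits of the averages *)

Section averages.
Context {d : measure_display} {T : measurableType d} {R : realType}.
Variables (P : probability T R) (u w : int -> {RV P >-> R}) (cu : R).
Hypothesis uwI : mutually_independent (joint_family u w).
Hypothesis u_ident : ident_distr u.
Hypothesis w_ident : ident_distr w.

Let A := `]cu, +oo[%classic : set R.

Let indicA (y : R) : \1_A y = (cu < y)%R%:R :> R.
Proof. by rewrite indicE /A mem_setE in_itv/= andbT. Qed.

Let mA : measurable A. Proof. exact: measurable_itv. Qed.

Let m_above : measurable_fun setT (fun y : R => (cu < y)%R%:R : R).
Proof.
rewrite (_ : (fun y => _) = \1_A); first exact: measurable_indic.
by apply/funext => y; rewrite indicA.
Qed.

(* The strong law is stated for products of two factors; here the first one is
   the indicator of the full space, evaluated at the irrelevant variable [w t]. *)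
Lemma u_average (h : R -> R) (c : nat -> R) :
  measurable_fun setT h ->
  P.-integrable setT (EFin \o (fun x => h (u 0 x))) ->
  (forall t, 0 <= c t <= 1) ->
  {ae P, forall x, (fun n => n%:R^-1 *
    (\sum_(1 <= t < n.+1) c t * h (u t%:Z x) -
     (\int[P]_x h (u 0 x)) * \sum_(1 <= t < n.+1) c t)) @ \oo --> 0}.
Proof.
move=> mh ih c01.
(* Here [k0] is 0: pairs at distinct times have no variable in common. *)
have uniq_ij (s t : nat) : s != t -> s != (t + 0)%N -> t != (s + 0)%N ->
    uniq [:: inr s.+1%:Z; inl s.+1%:Z; inr t.+1%:Z; inl t.+1%:Z : int + int].
  move=> /eqP st _ _.
  have ne (f : int -> int + int) : injective f -> (f s.+1 == f t.+1) = false.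
    by move=> fI; apply/eqP => /fI; lia.
  by rewrite /= !inE (ne _ (@inl_inj _ _)) (ne _ (@inr_inj _ _)).
have := slln_indep (Xi := w 0) (Xj := u 0) uwI uniq_ij
  (fun t => w_ident t.+1) (fun t => u_ident t.+1) (@measurableT _ R)
  (fun t => c01 t.+1) mh ih.
apply: filterS => x; apply: eq_cvgn => n; rewrite !big_add1.
congr (_ * (_ - _ * _)).
  by apply: eq_bigr => t _; rewrite indicT mul1r.
by rewrite preimage_setT (congr1 fine (probability_setT P)) mul1r.
Qed.

(** The second factor, named by [j t], will be an input at another time or a noise term. Sums start
    at time 1, so the strong law is applied to indices shifted by one. *)
Lemma above_average (j : nat -> int + int) (k0 : nat) (Xj : {RV P >-> R})
    (c : nat -> R) :
  (forall s t : nat, s != t -> s != (t + k0)%N -> t != (s + k0)%N ->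
    uniq [:: inl s%:Z; j s; inl t%:Z; j t]) ->
  (forall t B, measurable B ->
    P (joint_family u w (j t) @^-1` B) = P (Xj @^-1` B)) ->
  P.-integrable setT (EFin \o Xj) ->
  (forall t, 0 <= c t <= 1) ->
  {ae P, forall x, (fun n => n%:R^-1 *
    (\sum_(1 <= t < n.+1) c t * ((cu < u t%:Z x)%R%:R * joint_family u w (j t) x) -
     (fine (P [set x | cu < u 0 x]) * \int[P]_x Xj x)
     * \sum_(1 <= t < n.+1) c t)) @ \oo --> 0}.
Proof.
move=> uniq_j ident_j ij c01.
have uniq_ij (s t : nat) : s != t -> s != (t + k0)%N -> t != (s + k0)%N ->
    uniq [:: inl s.+1%:Z; j s.+1; inl t.+1%:Z; j t.+1 : int + int].
  by move=> *; apply: uniq_j; rewrite ?addSn ?eqSS.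
have := slln_indep (Xi := u 0) (Xj := Xj) (g := id) uwI uniq_ij
  (fun t => u_ident t.+1) (fun t => ident_j t.+1) mA
  (fun t => c01 t.+1) (@measurable_id _ _ _) ij.
apply: filterS => x; apply: eq_cvgn => n; rewrite !big_add1.
congr (_ * (_ - _ * _ * _)).
  by apply: eq_bigr => t _; rewrite indicA.
congr (fine (P _)); apply/seteqP; split=> y /=;
  by rewrite /A /= in_itv/= andbT.
Qed.

(** * Output averages and almost sure convergence of the estimator *)

Section assembly.
Variables (N : nat) (b : 'I_N -> R).
Hypothesis w_int : forall t, P.-integrable setT (EFin \o w t).
Hypothesis w_mean : forall t, ('E_P[w t] = 0)%E.
Hypothesis u_int : P.-integrable setT (EFin \o u 0).
Hypothesis above_gt0 : (0 < P [set x | (cu < u 0 x)%R])%E.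

Let p := fine (P [set x | cu < u 0 x]).
Let M := mean (u 0).
Let K := cond_mean_gt (u 0) cu.

Let preA : u 0 @^-1` A = [set x | cu < u 0 x].
Proof. by apply/seteqP; split=> y /=; rewrite /A /= in_itv/= andbT. Qed.

Lemma above_fine_gt0 : 0 < p.
Proof.
rewrite /p fine_gt0// above_gt0 /= -preA.
rewrite (le_lt_trans (probability_le1 P _)) ?ltry//.
exact: measurable_funPTI.
Qed.

Let mean_uE : \int[P]_x u 0 x = M.
Proof. by rewrite /M /mean expectation_def. Qed.

Let mean_above : \int[P]_x (cu < u 0 x)%R%:R = p.
Proof.
rewrite /p -preA -Rintegral_indic_comp//.
by apply: eq_Rintegral => x _; rewrite indicA.
Qed.

(** Multiplying by the positive probability [p] undoes the normalisation in [cond_mean_gt]. *)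
Let mean_u_above : \int[P]_x ((cu < u 0 x)%R%:R * u 0 x) = p * K.
Proof.
rewrite /K /cond_mean_gt -/p mulrCA mulfV ?mulr1 ?gt_eqF ?above_fine_gt0//.
rewrite -[RHS]/(Rintegral P _ (u 0)) [RHS]Rintegral_mkcond; apply: eq_Rintegral => x _.
rewrite /patch; case: ifPn; first by rewrite inE /= => ->; rewrite mul1r.
by rewrite notin_setE /= => /negP/negbTE ->; rewrite mul0r.
Qed.

Let adm01 t : 0 <= ((admissible N t)%:R : R) <= 1.
Proof. by case: admissible; rewrite /= ?lexx ?ler01. Qed.

Let one01 (t : nat) : 0 <= (1 : R) <= 1.
Proof. by rewrite ler01 lexx. Qed.

Let i_above : P.-integrable setT (EFin \o (fun x => (cu < u 0 x)%R%:R : R)).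
Proof.
apply: (@bounded_integrable _ _ _ _ _ 1); first exact: (measurableT_comp m_above).
by move=> x; case: (_ < _); rewrite ?normr1 ?normr0.
Qed.

Let m_u_above : measurable_fun setT (fun y : R => (cu < y)%R%:R * y : R).
Proof. exact: measurable_funM. Qed.

Let i_u_above : P.-integrable setT (EFin \o (fun x => (cu < u 0 x)%R%:R * u 0 x)).
Proof.
apply: (le_integrable measurableT _ _ u_int).
  by apply/measurable_EFinP; exact: (measurableT_comp m_u_above).
by move=> x _; rewrite /= lee_fin; case: (_ < _); rewrite ?mul1r// mul0r normr0.
Qed.

(** Tap [k] of the output at [t + m.+1] reads the input at [t + m - k]. For [k = m] this is [u t]
    itself, giving [p * K]; otherwise it is independent of the indicator, giving [p * M]. The noise
    contributes 0. *)
Lemma fir_average (m : 'I_N) : {ae P, forall x, (fun n => n%:R^-1 *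
  (\sum_(1 <= t < n.+1) (admissible N t)%:R * ((cu < u t%:Z x)%R%:R *
     fir_y b (fun t => u t x) (fun t => w t x) (t + m.+1)%:Z)
   - p * ((K - M) * b m + M * \sum_k b k)
     * \sum_(1 <= t < n.+1) (admissible N t)%:R)) @ \oo --> 0}.
Proof.
pose mu k := if k == m then p * K else p * M.
have Hu (k : 'I_N) : {ae P, forall x, (fun n => n%:R^-1 *
    (\sum_(1 <= t < n.+1) (admissible N t)%:R *
       ((cu < u t%:Z x)%R%:R * u ((t + m.+1)%:Z - k.+1%:Z) x)
     - mu k * \sum_(1 <= t < n.+1) (admissible N t)%:R)) @ \oo --> 0}.
  rewrite /mu; case: eqVneq => [->|km].
    have := u_average m_u_above i_u_above adm01.
    apply: filterS => x; apply: eq_cvgn => n; rewrite mean_u_above.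
    congr (_ * (_ - _)); apply: eq_bigr => t _.
    by rewrite PoszD addrK.
  pose j (t : nat) : int + int := inl ((t + m.+1)%:Z - k.+1%:Z).
  (* One of the two truncated differences is 0, so their sum is the distance between [k] and [m],
     the only nonzero lag at which two pairs share a variable. *)
  have uniq_j (s t : nat) : s != t -> s != (t + ((m - k) + (k - m)))%N ->
      t != (s + ((m - k) + (k - m)))%N ->
      uniq [:: inl s%:Z; j s; inl t%:Z; j t].
    move: km; rewrite -val_eqE /= => /eqP km /eqP st /eqP st1 /eqP st2.
    rewrite /= !inE /j !andbT !negb_or; apply/and3P; split.
    - by apply/and3P; split; apply/eqP => -[]; lia.
    - by apply/andP; split; apply/eqP => -[]; lia.
    - by apply/eqP => -[]; lia.
  have := above_average uniq_j (fun t => u_ident _) u_int adm01.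
  by rewrite mean_uE.
have Hw : {ae P, forall x, (fun n => n%:R^-1 *
    (\sum_(1 <= t < n.+1) (admissible N t)%:R *
       ((cu < u t%:Z x)%R%:R * w (t + m.+1)%:Z x))) @ \oo --> 0}.
  pose j (t : nat) : int + int := inr (t + m.+1)%:Z.
  have uniq_j (s t : nat) : s != t -> s != (t + 0)%N -> t != (s + 0)%N ->
      uniq [:: inl s%:Z; j s; inl t%:Z; j t].
    move=> /eqP st _ _; rewrite /= !inE /j !andbT !negb_or; apply/and3P; split=> //.
      by rewrite andbT; apply/eqP => -[]; lia.
    by apply/eqP => -[]; lia.
  have := above_average uniq_j (fun t => w_ident _) (w_int 0) adm01.
  apply: filterS => x; apply: eq_cvgn => n.
  have -> : \int[P]_x w 0 x = 0.
    by rewrite /Rintegral -expectation_def w_mean.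
  by rewrite mulr0 mul0r subr0.
have /filter_forall := Hu.
apply: filterS2 Hw => x Hwx Hux.
have muE : p * ((K - M) * b m + M * \sum_k b k) = \sum_k b k * mu k.
  rewrite (bigD1 m)//= [RHS](bigD1 m)//= /mu eqxx.
  under [in RHS]eq_bigr => k /negbTE -> do rewrite mulrC.
  by rewrite -mulr_sumr; ring.
pose hu (k : 'I_N) (n : nat) := n%:R^-1 *
    (\sum_(1 <= t < n.+1) (admissible N t)%:R *
       ((cu < u t%:Z x)%R%:R * u ((t + m.+1)%:Z - k.+1%:Z) x)
     - mu k * \sum_(1 <= t < n.+1) (admissible N t)%:R).
have Hbu k : (fun n => b k * hu k n) @ \oo --> (0 : R).
  by rewrite -(mulr0 (b k)); apply: cvgM; [exact: cvg_cst|exact: Hux].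
have Hs : (fun n => \sum_k b k * hu k n) @ \oo --> (0 : R).
  exact: cvg_sumn0.
apply: (cvgD0 Hwx Hs) => n; rewrite /hu; apply/esym.
under [X in _ + X = _]eq_bigr do rewrite mulrCA.
rewrite -[X in _ + X = _]mulr_sumr -mulrDr muE; congr (_ * _).
under [X in _ + X = _]eq_bigr do rewrite mulrBr mulrA mulr_sumr.
rewrite sumrB -mulr_suml exchange_big addrA -big_split /=.
congr (_ - _); apply: eq_bigr => t _; rewrite /fir_y mulrDr mulrDr addrC.
congr (_ + _); rewrite !mulr_sumr; apply: eq_bigr => k _.
by rewrite [LHS]mulrCA; congr (_ * _); rewrite mulrCA.
Qed.

(** The limits required by [bhat_cvg] hold simultaneously off a null set: there are four, besides a
    finite family indexed by the taps. *)
Lemma bhat_ae_cvg (alpha : nat -> R) : (0 < N)%N -> K != M ->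
  K != (1 - N%:R) * M ->
  (forall j, (0 < j)%N -> 0 < alpha j) ->
  series (fun j => alpha j.+1) @ \oo --> +oo ->
  cvg (series (fun j => alpha j.+1 ^+ 2) @ \oo) ->
  forall n : 'I_N, {ae P, forall x,
    (fun j => bhat b cu alpha (fun t => u t x) (fun t => w t x) j n ord0)
      @ \oo --> b n}.
Proof.
move=> N0 KM KNM a_gt0 a_div a_sqr n.
have /filter_forall := fir_average.
have := u_average m_above i_above adm01.
have := u_average m_u_above i_u_above one01.
have := u_average m_above i_above one01.
have := u_average (@measurable_id _ _ _) u_int one01.
rewrite mean_above mean_u_above mean_uE.
have sum1 k : \sum_(1 <= t < k.+1) 1 = k%:R :> R.
  by rewrite sumr_const_nat subn1.
move=> H1 H2 H3 H4 H5.
near=> x; apply: (@bhat_cvg R N b cu alpha (fun t => u t x) (fun t => w t x)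
  M K p) => //.
- exact: above_fine_gt0.
- have : (fun n => n%:R^-1 * (\sum_(1 <= t < n.+1) 1 * u t%:Z x -
    M * \sum_(1 <= t < n.+1) 1)) @ \oo --> 0 by near: x; exact: H1.
  apply: eq_cvgn => k; rewrite sum1; congr (_ * (_ - _)).
  by apply: eq_bigr => t _; rewrite mul1r.
- have : (fun n => n%:R^-1 * (\sum_(1 <= t < n.+1) 1 * (cu < u t%:Z x)%R%:R -
    p * \sum_(1 <= t < n.+1) 1)) @ \oo --> 0 by near: x; exact: H2.
  apply: eq_cvgn => k; rewrite sum1; congr (_ * (_ - _)).
  by apply: eq_bigr => t _; rewrite mul1r.
- have : (fun n => n%:R^-1 * (\sum_(1 <= t < n.+1)
    1 * ((cu < u t%:Z x)%R%:R * u t%:Z x) -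
    p * K * \sum_(1 <= t < n.+1) 1)) @ \oo --> 0 by near: x; exact: H3.
  apply: eq_cvgn => k; rewrite sum1; congr (_ * (_ - _)).
  by apply: eq_bigr => t _; rewrite mul1r.
- by near: x; exact: H4.
- by near: x; exact: H5.
Unshelve. all: by end_near. Qed.
End assembly.
End averages.

Unset Implicit Arguments.

Theorem theorem4 (d : measure_display) (T : measurableType d) (R : realType)
  (P : probability T R) (N : nat) (b : 'I_N -> R)
  (u w : int -> {RV P >-> R}) (cu : R) (alpha : nat -> R) :
  (0 < N)%N ->
  mutually_independent (joint_family u w) ->
  ident_distr u -> ident_distr w ->
  (forall t, P.-integrable setT (EFin \o w t)) ->
  (forall t, ('E_P[w t] = 0)%E) ->
  P.-integrable setT (EFin \o u 0) ->
  (0 < P [set x | (cu < u 0 x)%R])%E ->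
  cond_mean_gt (u 0) cu != mean (u 0) ->
  cond_mean_gt (u 0) cu != (1 - N%:R) * mean (u 0) ->
  (forall j, (0 < j)%N -> 0 < alpha j) ->
  series (fun j => alpha j.+1) @ \oo --> +oo ->
  cvg (series (fun j => alpha j.+1 ^+ 2) @ \oo) ->
  forall n : 'I_N,
    {ae P, forall x,
      (fun j => bhat b cu alpha (fun t => u t x) (fun t => w t x) j n ord0)
        @ \oo --> b n}.
Proof.
move=> N0 uwI u_ident w_ident w_int w_mean u_int above_gt0 KM KNM.
move=> a_gt0 a_div a_sqr.
exact: (bhat_ae_cvg uwI u_ident w_ident b w_int w_mean u_int above_gt0
  N0 KM KNM a_gt0 a_div a_sqr).
Qed.
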